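(* For every $\beta>1$ there are constants $C_1$ and $C_2$ depending only on $\beta$ such that the following holds. Let $u_0$ be a smooth divergence-free vector field on $\mathbb{R}^3$, periodic with period $1$ in each coordinate, $\omega_0=\nabla\wedge u_0$, and let $b(x,t)$, $t\ge0$, be a smooth time-dependent divergence-free vector field on $\mathbb{R}^3$, periodic with period $1$ in each coordinate of $x$, with $b(x,0)=u_0(x)$. Let $w(x,t)$ be the unique periodic solution of $$\partial_tw+(b\cdot\nabla)w-A(b)w-\tfrac12\Delta w=0,\qquad w(\cdot,0)=\omega_0,$$ and for each $t$ let $v(\cdot,t)$ be the unique periodic solution with mean zero ($\int_{[0,1]^3}v(x,t)\,\mathrm{d}x=0$) of the Poisson equation $\Delta v=-\nabla\wedge w$ in $\mathbb{R}^3$. Then $$|v(x,t)|\le C_1e^{C_2t\|b\|_\infty^2+2\sqrt t\,\|\nabla b\|_{0\to t}}\,\|\omega_0\|_\infty\qquad\text{for all }t\ge0,\ x\in[0,1]^3,$$ $$|\nabla v(x,t)|\le\frac{C_1}{\sqrt t}\,e^{C_2t\|b\|_\infty^2+3\sqrt t\,\|\nabla b\|_{0\to t}}\,\|\omega_0\|_\infty\qquad\text{for all }t>0,\ x\in[0,1]^3.$$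
   Context: $A(b)$ is the matrix field $A(b)_j^i=\partial_{x^j}b^i$, so $(A(b)w)^i=\sum_jw^j\partial_{x^j}b^i$. $\|\omega_0\|_\infty=\sup_{\mathbb{R}^3}|\omega_0|$, $\|b\|_\infty=\sup_{\mathbb{R}^3\times[0,\infty)}|b|$ and $\|f\|_{0\to t}=\sup_{(x,s)\in\mathbb{R}^3\times[0,t]}|\sqrt s\,f(x,s)|$ (for $t>0$ the bounds are vacuous if $\|b\|_\infty=\infty$ and $\omega_0\not\equiv 0$; at $t=0$ the exponent is read as $0$). *)

(* Defs.v *)
From HB Require Import structures.
From mathcomp Require Export all_boot all_order all_algebra.
From mathcomp Require Export all_classical all_reals all_analysis.
Set Implicit Arguments.
Unset Strict Implicit.
Unset Printing Implicit Defensive.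
Export Order.TTheory GRing.Theory Num.Theory.
Export numFieldNormedType.Exports.
#[export] Set Implicit Arguments.
#[export] Unset Strict Implicit.
#[export] Unset Printing Implicit Defensive.
Local Open Scope classical_set_scope.
Local Open Scope ring_scope.

(* In finite dimension, C^k in terms of all directional derivatives is the
   usual notion in terms of partial derivatives. *)
Fixpoint class_C {R : realType} {V W : normedModType R} (k : nat)
    (f : V -> W) : Prop :=
  match k with
  | 0%N => continuous f
  | k'.+1 => continuous f /\
      forall v : V, (forall x, derivable f x v) /\ class_C k' ('D_v f)
  end.

Definition smooth {R : realType} {V W : normedModType R} (f : V -> W) : Prop :=
  forall k, class_C k f.

(* Smoothness on the closed set [0, +oo[ x R^3, up to the boundary t = 0. *)
Definition smooth_t_ge0 {R : realType} (b : R -> 'rV[R]_3 -> 'rV[R]_3) : Prop :=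
  exists B : R * 'rV[R]_3 -> 'rV[R]_3,
    smooth B /\ forall (t : R) x, 0 <= t -> b t x = B (t, x).

Section VectorFields.
Context {R : realType}.
Implicit Types (u v w : 'rV[R]_3 -> 'rV[R]_3) (x : 'rV[R]_3).

Definition pd (j : 'I_3) u : 'rV[R]_3 -> 'rV[R]_3 := 'D_('e_j) u.

(* Row j is the partial derivative of u in x^j: the entry (j, i) is A(u)_j^i,
   and A(u)w is the row vector w *m gradmx u x. *)
Definition gradmx u x : 'M[R]_3 := \matrix_(j < 3) pd j u x.

Definition divergence u x : R := \sum_(i < 3) pd i u x 0 i.

(* The additions of indices are modulo 3. *)
Definition curl u x : 'rV[R]_3 :=
  \row_(i < 3) (pd (i + 1) u x 0 (i + 2%:R) - pd (i + 2%:R) u x 0 (i + 1)).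

Definition laplacian u x : 'rV[R]_3 := \sum_(j < 3) pd j (pd j u) x.

Definition periodic u : Prop := forall i x, u (x + 'e_i) = u x.

(* The integral of a continuous u over the unit cube, componentwise. *)
Definition cube_integral u : 'rV[R]_3 :=
  let mu := @lebesgue_measure R in
  \row_(i < 3) \int[mu]_(x1 in `[0, 1]) \int[mu]_(x2 in `[0, 1])
    \int[mu]_(x3 in `[0, 1]) u (\row_(j < 3) [:: x1; x2; x3]`_j) 0 i.

(* The norm `|x| of the library on matrices is the maximum norm. *)
Definition euclid x : R := Num.sqrt (\sum_(i < 3) x 0 i ^+ 2).

(* The operator norm for the Euclidean norm. *)
Definition opnorm (M : 'M[R]_3) : R :=
  sup [set euclid (h *m M) | h in [set h | euclid h <= 1]].

Definition sup_norm u : \bar R := ereal_sup [set (euclid (u x))%:E | x in setT].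

Definition sup_norm_t_ge0 (b : R -> 'rV[R]_3 -> 'rV[R]_3) : \bar R :=
  ereal_sup [set (euclid (b z.1 z.2))%:E | z in [set z : R * 'rV[R]_3 | 0 <= z.1]].

Definition norm_0_to (f : R -> 'rV[R]_3 -> 'M[R]_3) (t : R) : \bar R :=
  ereal_sup [set (opnorm (Num.sqrt z.1 *: f z.1 z.2))%:E
            | z in [set z : R * 'rV[R]_3 | 0 <= z.1 <= t]].

Definition continuous_t_gt0 (f : R -> 'rV[R]_3 -> 'rV[R]_3) : Prop :=
  forall (t : R) x, 0 < t -> {for (t, x), continuous (fun z => f z.1 z.2)}.

(* C^1 in time and C^2 in space for t > 0, continuous up to t = 0. *)
Definition parabolic_C12 (w : R -> 'rV[R]_3 -> 'rV[R]_3) : Prop :=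
  [/\ {within [set z : R * 'rV[R]_3 | 0 <= z.1],
        continuous (fun z => w z.1 z.2)},
      (forall (t : R) x, 0 < t -> derivable (w ^~ x) t 1) /\
        continuous_t_gt0 (fun t x => 'D_1 (w ^~ x) t),
      (forall t : R, 0 < t -> class_C 2 (w t)),
      (forall j, continuous_t_gt0 (fun t => pd j (w t))) &
      (forall j k, continuous_t_gt0 (fun t => pd j (pd k (w t))))].

(* w is a periodic classical solution of
   d_t w + (b . grad) w - A(b) w - (1/2) Lap w = 0 with w(., 0) = w0. *)
Definition vorticity_solution (b w : R -> 'rV[R]_3 -> 'rV[R]_3)
    (w0 : 'rV[R]_3 -> 'rV[R]_3) : Prop :=
  [/\ parabolic_C12 w,
      (forall t : R, 0 <= t -> periodic (w t)),
      (forall x, w 0 x = w0 x) &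
      (forall (t : R) x, 0 < t ->
         'D_1 (w ^~ x) t + \sum_(j < 3) b t x 0 j *: pd j (w t) x
         - w t x *m gradmx (b t) x - 2^-1 *: laplacian (w t) x = 0)].

(* v is the periodic mean-zero classical solution of Lap v = - curl w. *)
Definition poisson_solution w v : Prop :=
  [/\ class_C 2 v, periodic v, cube_integral v = 0 &
      forall x, laplacian v x = - curl w x].

End VectorFields.

(* Main.v *)
Require Import Defs.
From mathcomp Require Import ring lra.
Local Open Scope classical_set_scope.
Local Open Scope ring_scope.

(** The proof only uses maximum principles.
    - Testing the equation of [w] at a maximum of
      [|w(s, x)| exp (- 2 G sqrt s - s / t)], where [G] is the norm
      [0 -> t] of the gradient of [b], bounds [|w|] by
      [W := e exp (2 G sqrt t) ||omega_0||].
    - On [t/2, t] each component of [w] solves a scalar equation with drift [b]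
      and source bounded by [2 G W / sqrt t]. Doubling the space variable, with
      a penalty that is concave in each coordinate of [x - y], bounds its
      Lipschitz constant by
      [a := C W (1 / sqrt t + ||b|| + G) <= C W exp (t ||b||^2 + G sqrt t) / sqrt t].
    - If [Delta g = sum_d D_d f_d] on the torus with [|f_d| <= F], then
      [osc g <= 3/2 F]: the sum of [g] over a discrete box of half-sides
      [i, j, k <= n] has a discrete Laplacian controlled by the faces of the box,
      and is compared with the barrier [i j k (3 n C - C (i + j + k))], which
      agrees with it when the box is a whole period. With [f] made of the
      components of [w] this bounds [v] by [W]; with [f] made of those of
      [w - w(0)] it bounds [v] by [a].
    - [Delta v] is bounded by [a], so the doubling argument for the stationary
      function [v] bounds the gradient of [v] by [a] as well. *)

(** * One-dimensional calculus *)

Section calculus.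
Context {R : realType}.

(** The weight [2 G sqrt s + s / t] has derivative [G / sqrt s + 1 / t]: the first part is exactly
    the bound on the stretching term, the second makes the inequality at the maximum strict and
    costs only a factor [e]. In the doubling argument the drift is merely bounded, so its values at
    the two points are unrelated; they multiply a common derivative, of size at most the Lipschitz
    constant [a] that is sought. The concavity of the penalty must therefore beat a multiple of [a]
    itself, which turns the condition on [a] into a quadratic inequality. Its solution is linear in
    [||b||] and [G], and [1 + y <= 2 exp (y ^ 2)] with [y = ||b|| sqrt t] produces the exponent
    [t ||b||^2]; absorbing [1 + G sqrt t] likewise raises the coefficient 2 of the first exponent to
    3. A divergence has no pointwise bound in terms of [F], but its sum over a box is a flux through
    the faces. This is why the maximum principle for the Poisson equation is applied to the box sum
    as a function of the half-sides, and not to [g]. *)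

Lemma is_derive_line {V W : normedModType R} (f : V -> W) (x v : V) (h : R) :
  derivable f (h *: v + x) v ->
  is_derive h 1 (fun k : R => f (k *: v + x)) ('D_v f (h *: v + x)).
Proof.
have E : (fun k : R => k^-1 *: (((fun k : R => f (k *: v + x)) \o shift h) (k *: 1) - f (h *: v + x)))
   = (fun k : R => k^-1 *: ((f \o shift (h *: v + x)) (k *: v) - f (h *: v + x))).
  by apply/funext => k /=; rewrite scalerDl [k%:A]mulr1 addrA.
move=> df; apply: DeriveDef; first by rewrite /derivable E.
by rewrite /derive E.
Qed.

Lemma derive_approx {V : normedModType R} (f : V -> R) (x v : V) (e : R) :
  derivable f x v -> 0 < e -> exists2 d, 0 < d &
  forall h, 0 < `|h| < d -> `|f (h *: v + x) - f x - 'D_v f x * h| <= e * `|h|.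
Proof.
move=> df e0; move/cvgrPdist_le : (df) => /(_ _ e0)[/= d d0 dle].
exists d => // h /andP[h0 hd].
have := dle h; rewrite /ball_ /= sub0r normrN -normr_gt0 h0 => /(_ hd isT).
rewrite -/('D_v f x) => H.
have hn0 : h != 0 by rewrite -normr_gt0.
have -> : f (h *: v + x) - f x - 'D_v f x * h =
    - (('D_v f x - h^-1 * (f (h *: v + x) - f x)) * h) by field.
by rewrite normrN normrM ler_wpM2r.
Qed.

(** Only times before [t] are compared, so that the lemma also serves for a maximum at the last time
    of a closed interval. *)
Lemma derive_le_touching (f g : R -> R) (t d : R) : 0 < d ->
  derivable f t 1 -> derivable g t 1 -> f t = g t ->
  (forall s, t - d < s < t -> f s <= g s) -> 'D_1 g t <= 'D_1 f t.
Proof.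
move=> d0 df dg fgt fg; rewrite leNgt; apply/negP => lt_fg.
set e := ('D_1 g t - 'D_1 f t) / 4.
have e0 : 0 < e by rewrite /e; lra.
have [d1 d10 H1] := derive_approx df e0.
have [d2 d20 H2] := derive_approx dg e0.
set h := Num.min d (Num.min d1 d2) / 2.
have m0 : 0 < Num.min d (Num.min d1 d2) by rewrite !lt_min d0 d10 d20.
have : Num.min d (Num.min d1 d2) <= d by rewrite ge_min lexx.
have : Num.min d (Num.min d1 d2) <= d1 by rewrite !ge_min lexx orbT.
have : Num.min d (Num.min d1 d2) <= d2 by rewrite !ge_min lexx !orbT.
move=> a1 a2 a3.
have h0 : 0 < h by rewrite /h; lra.
have nh : `|- h| = h by rewrite normrN gtr0_norm.
have := H1 (- h); have := H2 (- h); rewrite nh h0 /=.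
have -> : h < d2 by rewrite /h; lra.
have -> : h < d1 by rewrite /h; lra.
have -> : (- h)%:A + t = t - h by rewrite [_%:A]mulr1 addrC.
move=> /(_ isT); rewrite ler_norml => /andP[_ A].
move=> /(_ isT); rewrite ler_norml => /andP[B _].
have : f (t - h) <= g (t - h) by apply: fg; apply/andP; split; rewrite /h; lra.
move: A B; rewrite fgt => A B C.
have E : ('D_1 g t - 'D_1 f t) * h = 4 * (e * h) by rewrite /e; field.
have : 4 * (e * h) <= 2 * (e * h) by rewrite -E; lra.
have := mulr_gt0 e0 h0; lra.
Qed.

(** First and second order conditions at a local maximum of [f] minus a quadratic polynomial. The
    second derivative is only needed at [x]: if it exceeded [2 b], the expansion of ['D_v f] at [x]
    would make the derivative of the difference positive at the point given by the mean value
    theorem. *)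
Lemma derive_le_quadratic {V : normedModType R} (f : V -> R) (x v : V) (a b d : R) :
  0 < d -> (forall y, derivable f y v) -> derivable ('D_v f) x v ->
  (forall h, `|h| < d -> f (h *: v + x) <= f x + a * h + b * h ^+ 2) ->
  'D_v f x = a /\ 'D_v ('D_v f) x <= 2 * b.
Proof.
move=> d0 df ddf fle.
have fst : 'D_v f x = a.
  apply/eqP; rewrite eq_sym -subr_eq0; apply/negPn/negP => ne.
  set L := 'D_v f x in ne *.
  (* With this [e], [key] at an [h] of the sign of [L - a] says that [|a - L| * |h|] is at most half
     of itself. *)
  set e := `|a - L| / 4.
  have q0 : 0 < `|a - L| by rewrite normr_gt0.
  have e0 : 0 < e by rewrite /e; lra.
  have [d1 d10 H1] := derive_approx (df x) e0.
  set d2 := e / (`|b| + 1).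
  have b1 : 0 < `|b| + 1 by rewrite ltr_wpDl.
  have d20 : 0 < d2 by rewrite divr_gt0.
  set m := Num.min d (Num.min d1 d2).
  have m0 : 0 < m by rewrite !lt_min d0 d10 d20.
  have md : m <= d by rewrite ge_min lexx.
  have md1 : m <= d1 by rewrite !ge_min lexx orbT.
  have md2 : m <= d2 by rewrite !ge_min lexx !orbT.
  have key h : `|h| = m / 2 -> (L - a) * h <= 2 * e * `|h|.
    move=> hm.
    have hd : `|h| < d by rewrite hm; lra.
    have := H1 h; have -> : 0 < `|h| < d1 by rewrite hm; apply/andP; split; lra.
    move=> /(_ isT); rewrite ler_norml => /andP[A _].
    have B := fle h hd.
    have : b * h ^+ 2 <= e * `|h|.
      apply: (@le_trans _ _ (`|b| * h ^+ 2)).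
        by apply: ler_wpM2r; [exact: sqr_ge0 | exact: ler_norm].
      rewrite -real_normK ?num_real// expr2 mulrA; apply: ler_wpM2r => //.
      apply: (@le_trans _ _ ((`|b| + 1) * d2)); last first.
        by rewrite /d2 mulrC divfK ?gt_eqF.
      apply: ler_pM => //; first by lra.
      rewrite hm; lra.
    by rewrite -/L in A *; lra.
  have m20 : 0 <= m / 2 by lra.
  have [ale|alt] := leP 0 (a - L).
    have := key (- (m / 2)); rewrite normrN ger0_norm// => /(_ erefl).
    rewrite /e ger0_norm// => K.
    have : a - L != 0 by [].
    move: q0; rewrite ger0_norm// => q0 _; nra.
  have := key (m / 2); rewrite ger0_norm// => /(_ erefl).
  rewrite /e ltr0_norm// => K.
  move: q0; rewrite ltr0_norm// => q0; nra.
split => //; rewrite leNgt; apply/negP => lt_b.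
set L := 'D_v ('D_v f) x in lt_b.
set e := (L - 2 * b) / 2.
have e0 : 0 < e by rewrite /e; lra.
have [d1 d10 H1] := derive_approx ddf e0.
set h1 := Num.min d d1 / 2.
have m0 : 0 < Num.min d d1 by rewrite !lt_min d0 d10.
have md : Num.min d d1 <= d by rewrite ge_min lexx.
have md1 : Num.min d d1 <= d1 by rewrite !ge_min lexx orbT.
have h10 : 0 < h1 by rewrite /h1; lra.
pose k := fun h : R => f (h *: v + x) - (a * h + b * (h * h)).
have dk (h : R) : is_derive h 1 k ('D_v f (h *: v + x) - (a + b * (h + h))).
  have := is_derive_line (df (h *: v + x)) => D1.
  have D2 : is_derive h 1 (fun h : R => a * h + b * (h * h)) (a + b * (h + h)).
    by apply: is_derive_eq; rewrite /GRing.scale /=; ring.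
  exact: (@is_deriveB _ _ _ _ _ _ _ _ _ D1 D2).
have ck : {within `[0, h1], continuous k}.
  apply: derivable_within_continuous => h _; exact: (@ex_derive _ _ _ _ _ _ _ (dk h)).
have [c cin kc] := MVT h10 (fun h _ => dk h) ck.
have c0 : 0 < c by rewrite (itvP cin).
have ch : c < h1 by rewrite (itvP cin).
have hd : `|h1| < d by rewrite gtr0_norm// /h1; lra.
have K : k h1 - k 0 <= 0.
  rewrite /k scale0r add0r; have := fle _ hd; rewrite expr2; lra.
have := H1 c; rewrite gtr0_norm// c0 /= => /(_ _)/wrap[].
  by rewrite /h1 in ch; lra.
rewrite fst ler_norml => /andP[A _].
rewrite kc in K.
have : 0 < ('D_v f (c *: v + x) - (a + b * (c + c))) * (h1 - 0).
  apply: mulr_gt0; last by lra.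
  rewrite -/L /e in A.
  have : 0 < (L - 2 * b) * c by apply: mulr_gt0 => //; lra.
  lra.
lra.
Qed.

End calculus.

(** * Periodic functions *)

Section periodicity.
Context {R : realType}.
Notation E := 'rV[R]_3.

(** The group and the step are arbitrary because the lemma serves both for the periods of the
    lattice and for the steps of the mesh. *)
Lemma shift_int_invariant {T : zmodType} {A : Type} (phi : T -> A) p :
  (forall x, phi (x + p) = phi x) -> forall (m : int) x, phi (x + p *~ m) = phi x.
Proof.
move=> phiP; have nat_case (m : nat) x : phi (x + p *+ m) = phi x.
  by elim: m => [|m IH]; rewrite ?mulr0n ?addr0// mulrSr addrA phiP.
case=> m x; first exact: nat_case.
by rewrite NegzE mulrNz -(nat_case m.+1 (x - _)) addrNK.
Qed.

Definition lattice_vec (m : 'I_3 -> int) : E := \sum_i (m i)%:~R *: 'e_i.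

Lemma lattice_vecE m i : lattice_vec m 0 i = (m i)%:~R.
Proof.
rewrite summxE (bigD1 i)//= !mxE !eqxx mulr1 big1 ?addr0// => j ji.
by rewrite !mxE eqxx eq_sym (negbTE ji) mulr0.
Qed.

Definition shift_periodic {A : Type} (g : E -> A) := forall i x, g (x + 'e_i) = g x.

Lemma shift_periodic_lattice {A : Type} (g : E -> A) m x :
  shift_periodic g -> g (x + lattice_vec m) = g x.
Proof.
move=> gP; rewrite /lattice_vec big_ord_recl big_ord_recl big_ord_recl big_ord0 addr0 !addrA.
by rewrite !scaler_int !(shift_int_invariant (gP _)).
Qed.

Lemma unit_cube_reduction (x : E) : exists m, forall i, 0 <= (x + lattice_vec m) 0 i <= 1.
Proof.
exists (fun i => - Num.floor (x 0 i)) => i.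
rewrite mxE lattice_vecE intrN subr_ge0 lerBlDr ge_floor/=.
by rewrite addrC ltW// -[1]/(1%:~R) -intrD floorD1_gt.
Qed.

Definition cube (a b : R) : set E := [set x | forall i, x 0 i \in `[a, b]].

Lemma compact_cube a b : compact (cube a b).
Proof.
apply: (@rV_compact _ 3 (fun=> [set` `[a, b]])) => _; exact: segment_compact.
Qed.

(** Near each [x] of the unit cube the estimate holds for all pairs close to [(x, 0)]; compactness
    gives one neighbourhood of 0 for the whole cube, and lattice translations reach the other
    points. *)
Lemma unif_continuous_periodic (g : E -> R) (e : R) : continuous g ->
  shift_periodic g -> 0 < e -> exists2 d, 0 < d &
  forall x z, `|z| < d -> `|g (x + z) - g x| <= e.
Proof.
move=> cg gP e0.
have /compact_near_coveringP := @compact_cube 0 1.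
move=> /(_ E (nbhs (0 : E)) (fun z x => `|g (x + z) - g x| <= e) _) K.
have H : \forall z \near (0 : E), cube 0 1 `<=` (fun x => `|g (x + z) - g x| <= e).
  apply: K => x _.
  have c : {for (x, 0 : E), continuous (fun z : E * E => g (z.1 + z.2) - g z.1)}.
    apply: continuousB; last by apply: continuous_comp; [exact: cvg_fst|exact: cg].
    by apply: continuous_comp; [apply: continuousD; [exact: cvg_fst|exact: cvg_snd]|exact: cg].
  move/cvgrPdist_le : c => /(_ _ e0); rewrite addr0 subrr.
  by apply: filterS => -[x' z] /=; rewrite sub0r normrN.
have [d /= d0 dP] := (@nbhs_ballP R E _ _).1 H; exists d => // x z zd.
have [m mP] := unit_cube_reduction x.
rewrite -(shift_periodic_lattice m x gP) -(shift_periodic_lattice m (x + z) gP) addrAC.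
by apply: (dP z); [rewrite -ball_normE /ball_/= sub0r normrN | move=> i; rewrite in_itv/=].
Qed.

Lemma norm_rV_lt (z : E) (d : R) : (forall i, `|z 0 i| < d) -> `|z| < d.
Proof.
move=> zd; rewrite [`|z|]/Num.Def.normr/= mx_normrE; apply: bigmax_lt.
  by apply: le_lt_trans (zd 0).
by move=> -[i j] _ /=; rewrite ord1.
Qed.

Lemma fst_taylor (f : E -> R) x v (h e : R) : 0 <= h ->
  (forall y, derivable f y v) ->
  (forall k, 0 <= k <= h -> `|'D_v f (x + k *: v) - 'D_v f x| <= e) ->
  `|f (x + h *: v) - f x - h * 'D_v f x| <= h * e.
Proof.
move=> h0 df De.
pose k := fun s : R => f (s *: v + x).
have dk (s : R) : is_derive s 1 k ('D_v f (s *: v + x)) by exact: is_derive_line.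
have ck : {within `[0, h], continuous k}.
  by apply: derivable_within_continuous => s _; exact: (@ex_derive _ _ _ _ _ _ _ (dk s)).
have [c cin kc] := MVT_segment h0 (fun s _ => dk s) ck.
have -> : f (x + h *: v) - f x = k h - k 0 by rewrite /k scale0r add0r (addrC x).
rewrite kc subr0 (mulrC _ h) -mulrBr normrM ger0_norm//; apply: ler_wpM2l => //.
by rewrite (addrC _ x); apply: De; rewrite in_itv/= in cin.
Qed.

(** The mean value theorem is applied to the even function [k] on [[0, h]] and then to [q] on
    [[- c, c]]. The factor 2 in the error comes from bounding [2 c h] by [2 h ^ 2]. *)
Lemma snd_taylor (f : E -> R) x v (h e : R) : 0 <= h ->
  (forall y, derivable f y v) -> (forall y, derivable ('D_v f) y v) ->
  (forall k, `|k| <= h -> `|'D_v ('D_v f) (x + k *: v) - 'D_v ('D_v f) x| <= e) ->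
  `|f (x + h *: v) + f (x - h *: v) - 2 * f x - h ^+ 2 * 'D_v ('D_v f) x| <= 2 * h ^+ 2 * e.
Proof.
move=> h0 df ddf De; set L := 'D_v ('D_v f) x.
have h1 (f' : E -> R) (dd : forall y, derivable f' y v) (s : R) :
    is_derive s 1 (fun k : R => f' (k *: v + x)) ('D_v f' (s *: v + x)).
  exact: is_derive_line.
pose k := fun s : R => f (s *: v + x) + f ((- s) *: v + x) - s * s * L.
pose p := fun s : R => 'D_v f (s *: v + x) - 'D_v f ((- s) *: v + x) - (s + s) * L.
have h2 (f' : E -> R) (dd : forall y, derivable f' y v) (s : R) :
    is_derive s 1 (fun k : R => f' ((- k) *: v + x)) (- 'D_v f' ((- s) *: v + x)).
  have := is_derive1_comp (h1 f' dd (- s)) (is_deriveN (is_derive_id s 1)).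
  by rewrite /= mulrN1.
have dk (s : R) : is_derive s 1 k (p s).
  have D3 : is_derive s 1 (fun s : R => s * s * L) ((s + s) * L).
    by apply: is_derive_eq; rewrite /GRing.scale /=; ring.
  exact: (@is_deriveB _ _ _ _ _ _ _ _ _ (@is_deriveD _ _ _ _ _ _ _ _ _ (h1 f df s) (h2 f df s)) D3).
have ck : {within `[0, h], continuous k}.
  by apply: derivable_within_continuous => s _; exact: (@ex_derive _ _ _ _ _ _ _ (dk s)).
have [c cin kc] := MVT_segment h0 (fun s _ => dk s) ck.
have /andP[c0 ch] : 0 <= c <= h by rewrite in_itv/= in cin.
pose q := fun s : R => 'D_v f (s *: v + x) - s * L.
have dq (s : R) : is_derive s 1 q ('D_v ('D_v f) (s *: v + x) - L).
  have D3 : is_derive s 1 (fun s : R => s * L) L.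
    by apply: is_derive_eq; rewrite /GRing.scale /=; ring.
  exact: (@is_deriveB _ _ _ _ _ _ _ _ _ (h1 _ ddf s) D3).
have cq : {within `[- c, c], continuous q}.
  by apply: derivable_within_continuous => s _; exact: (@ex_derive _ _ _ _ _ _ _ (dq s)).
have cc : - c <= c by lra.
have [d din qd] := MVT_segment cc (fun s _ => dq s) cq.
have -> : f (x + h *: v) + f (x - h *: v) - 2 * f x - h ^+ 2 * L = k h - k 0.
  by rewrite /k oppr0 scale0r add0r !scaleNr !(addrC x) (addrC (- _)); ring.
have pc : p c = q c - q (- c) by rewrite /p /q; ring.
rewrite kc subr0 pc qd opprK.
have -> : ('D_v ('D_v f) (d *: v + x) - L) * (c + c) * h =
  2 * (c * h) * ('D_v ('D_v f) (d *: v + x) - L) by ring.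
have ch0 : 0 <= 2 * (c * h) by rewrite mulr_ge0// mulr_ge0.
rewrite normrM (ger0_norm ch0); apply: ler_pM => //.
  by rewrite expr2 ler_pM2l// ler_wpM2r.
rewrite (addrC _ x); apply: De; rewrite in_itv/= in din; move: din => /andP[d1 d2].
rewrite ler_norml; lra.
Qed.

End periodicity.

(** * Discrete box sums and the barrier *)

Section box_sums.
Context {R : realType} {T : zmodType}.
Implicit Types (f g : T -> R) (p q r x : T) (i j k n : nat).

(* The 2i points x + a p with - i <= a < i: with this asymmetric range box_sum
   vanishes at i = 0 and commutes with second differences. *)
Definition box_sum p i g x : R :=
  \sum_(k < i) (g (x + p *+ k) + g (x - p *+ k.+1)).

Definition fst_diff p f x : R := f (x + p) - f x.

Definition snd_diff p g x : R := g (x + p) + g (x - p) - 2 * g x.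

Lemma box_sum0 p g x : box_sum p 0 g x = 0.
Proof. by rewrite /box_sum big_ord0. Qed.

Lemma box_sumS p i g x :
  box_sum p i.+1 g x = box_sum p i g x + (g (x + p *+ i) + g (x - p *+ i.+1)).
Proof. by rewrite /box_sum big_ord_recr. Qed.

Lemma box_sumC p i q j g x :
  box_sum p i (box_sum q j g) x = box_sum q j (box_sum p i g) x.
Proof.
rewrite /box_sum.
under eq_bigr do rewrite -big_split/=.
rewrite exchange_big/=; apply: eq_bigr => k _.
rewrite -big_split/=; apply: eq_bigr => l _.
by rewrite !(addrAC x (p *+ l)) !(addrAC x (- (p *+ l.+1))); ring.
Qed.

Lemma eq_box_sum p i f g x : f =1 g -> box_sum p i f x = box_sum p i g x.
Proof. by move=> fg; apply: eq_bigr => k _; rewrite !fg. Qed.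

Lemma box_sumD p i f g x :
  box_sum p i (fun y => f y + g y) x = box_sum p i f x + box_sum p i g x.
Proof. by rewrite /box_sum -big_split; apply: eq_bigr => k _ /=; ring. Qed.

Lemma box_sumN p i f x : box_sum p i (fun y => - f y) x = - box_sum p i f x.
Proof. by rewrite /box_sum -sumrN; apply: eq_bigr => k _ /=; ring. Qed.

Lemma box_sum_ge p i g x (c : R) : (forall y, c <= g y) ->
  2 * i%:R * c <= box_sum p i g x.
Proof.
move=> cg; elim: i => [|i IH]; first by rewrite box_sum0 mulr0 mul0r.
rewrite box_sumS -natr1; have := cg (x + p *+ i); have := cg (x - p *+ i.+1).
lra.
Qed.

Lemma box_sum_cst p i (c : R) x : box_sum p i (fun=> c) x = 2 * i%:R * c.
Proof.
rewrite /box_sum sumr_const card_ord -mulr_natl; ring.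
Qed.

Lemma box_sum_fst_diff p i f x :
  box_sum p i (fst_diff p f) x = f (x + p *+ i) - f (x - p *+ i).
Proof.
elim: i => [|i IH]; first by rewrite box_sum0 mulr0n addr0 subr0 subrr.
rewrite box_sumS IH /fst_diff.
have -> : x + p *+ i + p = x + p *+ i.+1 by rewrite mulrSr addrA.
have -> : x - p *+ i.+1 + p = x - p *+ i by rewrite mulrSr opprD addrA addrNK.
ring.
Qed.

(** Discrete form of the fact that the integral of [g''] over [[x - r, x + r]] is the second
    derivative in [r] of the integral of [g]. *)
Lemma box_sum_snd_diff p i g x : box_sum p i.+1 (snd_diff p g) x =
  box_sum p i.+2 g x + box_sum p i g x - 2 * box_sum p i.+1 g x.
Proof.
elim: i => [|i IH].
  rewrite !box_sumS !box_sum0 /snd_diff !(mulr0n, mulr1n, mulr2n) !addr0.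
  by rewrite addrNK opprD (addrA x); ring.
rewrite box_sumS IH !box_sumS /snd_diff.
have -> : x + p *+ i.+1 + p = x + p *+ i.+2 by rewrite [p *+ i.+2]mulrSr addrA.
have -> : x + p *+ i.+1 - p = x + p *+ i by rewrite mulrSr addrA addrK.
have -> : x - p *+ i.+2 + p = x - p *+ i.+1 by rewrite [p *+ i.+2]mulrSr opprD addrA addrNK.
have -> : x - p *+ i.+2 - p = x - p *+ i.+3 by rewrite -addrA -opprD -mulrSr.
ring.
Qed.

Lemma box_sum_fst_diff_periodic p n f x : (forall y, f (y + p *+ n.*2) = f y) ->
  box_sum p n (fst_diff p f) x = 0.
Proof.
move=> fP; rewrite box_sum_fst_diff -(fP (x - _)) -addnn mulrnDr addrA addrNK.
by rewrite subrr.
Qed.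

Lemma fst_diffN p g x : fst_diff p (fun y => g (y - p)) x = g x - g (x - p).
Proof. by rewrite /fst_diff addrK. Qed.

Lemma box_sum_snd_diff_periodic p n g x : (forall y, g (y + p *+ n.*2) = g y) ->
  box_sum p n (snd_diff p g) x = 0.
Proof.
move=> gP; rewrite (@eq_box_sum _ _ _ (fun y => fst_diff p g y + - fst_diff p (fun y => g (y - p)) y)).
  rewrite box_sumD box_sumN !box_sum_fst_diff_periodic ?subr0// => y.
  by rewrite addrAC gP.
by move=> y; rewrite fst_diffN /fst_diff /snd_diff; ring.
Qed.

Lemma box_sum_shift p n g x : (forall y, g (y + p *+ n.*2) = g y) ->
  box_sum p n g (x + p) = box_sum p n g x.
Proof.
move=> gP; apply/eqP; rewrite -subr_eq0 -(box_sum_fst_diff_periodic x gP).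
apply/eqP; rewrite /fst_diff box_sumD box_sumN; congr (_ - _).
by apply: eq_bigr => k _; rewrite !(addrAC x p _).
Qed.

Definition box3 p i q j r k g := box_sum p i (box_sum q j (box_sum r k g)).

Lemma box3_swap12 p i q j r k g x : box3 p i q j r k g x = box3 q j p i r k g x.
Proof. exact: box_sumC. Qed.

Lemma box3_swap23 p i q j r k g x : box3 p i q j r k g x = box3 p i r k q j g x.
Proof. by apply: eq_box_sum => y; exact: box_sumC. Qed.

Lemma box3_rot p i q j r k g x : box3 p i q j r k g x = box3 q j r k p i g x.
Proof. by rewrite box3_swap12 box3_swap23. Qed.

Lemma eq_box3 p i q j r k f g x : f =1 g ->
  box3 p i q j r k f x = box3 p i q j r k g x.
Proof. by move=> fg; do 3!(apply: eq_box_sum => ?); exact: fg. Qed.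

Lemma box3D p i q j r k f g x : box3 p i q j r k (fun y => f y + g y) x =
  box3 p i q j r k f x + box3 p i q j r k g x.
Proof.
rewrite /box3 -box_sumD; apply: eq_box_sum => y.
by rewrite -box_sumD; apply: eq_box_sum => z; rewrite -box_sumD.
Qed.

Lemma box3N p i q j r k f x :
  box3 p i q j r k (fun y => - f y) x = - box3 p i q j r k f x.
Proof.
rewrite /box3 -box_sumN; apply: eq_box_sum => y.
by rewrite -box_sumN; apply: eq_box_sum => z; rewrite -box_sumN.
Qed.

Lemma box3_ge p i q j r k g x (c : R) : (forall y, c <= g y) ->
  8 * i%:R * j%:R * k%:R * c <= box3 p i q j r k g x.
Proof.
move=> cg.
have -> : 8 * i%:R * j%:R * k%:R * c = 2 * i%:R * (2 * j%:R * (2 * k%:R * c)) by ring.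
by do 3!(apply: box_sum_ge => ?).
Qed.

Lemma box3_cst p i q j r k (c : R) x :
  box3 p i q j r k (fun=> c) x = 8 * i%:R * j%:R * k%:R * c.
Proof.
rewrite /box3 (@eq_box_sum _ _ _ (fun=> 2 * j%:R * (2 * k%:R * c))).
  by rewrite box_sum_cst; ring.
move=> y; rewrite (@eq_box_sum _ _ _ (fun=> 2 * k%:R * c)) ?box_sum_cst//.
by move=> z; rewrite box_sum_cst.
Qed.

(** Puts the direction [p] innermost, where the one-dimensional identities apply at every position
    in the other two directions. *)
Lemma box3_inner p i q j r k g x :
  box3 p i q j r k g x = box_sum q j (box_sum r k (box_sum p i g)) x.
Proof. by rewrite box3_rot. Qed.

Lemma box_sum_snd_diffC p q j g x :
  box_sum q j (snd_diff p g) x = snd_diff p (box_sum q j g) x.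
Proof.
rewrite /box_sum /snd_diff mulr_sumr -big_split/= -sumrB.
by apply: eq_bigr => k _; rewrite !(addrAC x (q *+ k)) !(addrAC x (- (q *+ k.+1))); ring.
Qed.

Lemma box3_snd_diff p i q j r k g x : box3 p i.+1 q j r k (snd_diff p g) x =
  box3 p i.+2 q j r k g x + box3 p i q j r k g x - 2 * box3 p i.+1 q j r k g x.
Proof.
rewrite -box_sum_snd_diff; apply: eq_box_sum => y.
rewrite -box_sum_snd_diffC; apply: eq_box_sum => z.
by rewrite box_sum_snd_diffC.
Qed.

Lemma box3_snd_diff_periodic p n q j r k g x :
  (forall y, g (y + p *+ n.*2) = g y) -> box3 p n q j r k (snd_diff p g) x = 0.
Proof.
move=> gP; rewrite box3_inner (@eq_box_sum _ _ _ (fun=> 0)).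
  by rewrite box_sum_cst mulr0.
move=> y; rewrite (@eq_box_sum _ _ _ (fun=> 0)) ?box_sum_cst ?mulr0// => z.
exact: box_sum_snd_diff_periodic.
Qed.

Lemma box3_fst_diff_periodic p n q j r k f x :
  (forall y, f (y + p *+ n.*2) = f y) -> box3 p n q j r k (fst_diff p f) x = 0.
Proof.
move=> fP; rewrite box3_inner (@eq_box_sum _ _ _ (fun=> 0)).
  by rewrite box_sum_cst mulr0.
move=> y; rewrite (@eq_box_sum _ _ _ (fun=> 0)) ?box_sum_cst ?mulr0// => z.
exact: box_sum_fst_diff_periodic.
Qed.

(** A discrete divergence theorem: summation along [p] telescopes to two opposite faces of
    [2 j * 2 k] points each. *)
Lemma box3_fst_diff_ge p i q j r k f x (F : R) : (forall y, `|f y| <= F) ->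
  - (8 * F * (j%:R * k%:R)) <= box3 p i q j r k (fst_diff p f) x.
Proof.
move=> fF; rewrite box3_inner.
have -> : - (8 * F * (j%:R * k%:R)) = 2 * j%:R * (2 * k%:R * (- 2 * F)) by ring.
apply: box_sum_ge => y; apply: box_sum_ge => z; rewrite box_sum_fst_diff.
have := fF (z + p *+ i); have := fF (z - p *+ i).
by rewrite !ler_norml => /andP[? ?] /andP[? ?]; lra.
Qed.

(** The last hypothesis is the second order condition at a maximum of the box sum minus the barrier,
    whose second difference in this direction is [- 2 C j k]. It is available only while the box can
    still grow; otherwise the box is a whole period and both differences sum to 0. *)
Lemma box3_direction p i q j r k f g x n (F C : R) :
  (i.+1 <= n)%N -> (forall y, `|f y| <= F) ->
  (forall y, f (y + p *+ n.*2) = f y) -> (forall y, g (y + p *+ n.*2) = g y) ->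
  ((i.+1 < n)%N -> box3 p i.+2 q j r k g x + box3 p i q j r k g x
     - 2 * box3 p i.+1 q j r k g x <= - (2 * C * (j%:R * k%:R))) ->
  box3 p i.+1 q j r k (fun y => snd_diff p g y + - fst_diff p f y) x <=
  if (i.+1 < n)%N then - ((2 * C - 8 * F) * (j%:R * k%:R)) else 0.
Proof.
move=> lein fF fP gP Hmax; rewrite box3D box3N.
case: ifPn => [ltin|]; last first.
  rewrite -leqNgt => lenin; have ein : i.+1 = n by apply/eqP; rewrite eqn_leq lein.
  by rewrite ein box3_snd_diff_periodic// box3_fst_diff_periodic// subr0.
rewrite box3_snd_diff; have := Hmax ltin.
have := @box3_fst_diff_ge p i.+1 q j r k f x F fF.
lra.
Qed.

Section barrier.
Variables (p0 p1 p2 : T) (f0 f1 f2 g : T -> R) (n : nat) (F e C : R).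
Hypothesis gP : forall p, p \in [:: p0; p1; p2] -> forall y, g (y + p *+ n.*2) = g y.
Hypotheses (f0P : forall y, f0 (y + p0 *+ n.*2) = f0 y)
  (f1P : forall y, f1 (y + p1 *+ n.*2) = f1 y)
  (f2P : forall y, f2 (y + p2 *+ n.*2) = f2 y).
Hypotheses (f0F : forall y, `|f0 y| <= F) (f1F : forall y, `|f1 y| <= F)
  (f2F : forall y, `|f2 y| <= F).
Hypothesis e0 : 0 <= e.
(** Here [e] is a discretization error. The bound is one-sided, because only upper bounds on box
    sums are derived; lower bounds come from [- g]. *)
Hypothesis Hlap : forall y, - e <=
  (snd_diff p0 g y + - fst_diff p0 f0 y) + (snd_diff p1 g y + - fst_diff p1 f1 y)
  + (snd_diff p2 g y + - fst_diff p2 f2 y).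
(** Directions in which the box is full contribute nothing, so a single direction must beat the
    whole error: [8 e n < 2 C - 8 F]. *)
Hypothesis HC : 4 * F + 4 * e * n%:R < C.

Let B (i j k : nat) : R := i%:R * j%:R * k%:R * (3 * n%:R * C - C * (i%:R + j%:R + k%:R)).

(* In a direction where the box is a whole period, the box sums of the first and
   second differences both vanish, so that the faces i = n need no boundary
   condition except at the corner (n, n, n). *)
Lemma box3_le_barrier x (i j k : nat) : box3 p0 n p1 n p2 n g x = 0 ->
  (i <= n)%N -> (j <= n)%N -> (k <= n)%N ->
  box3 p0 i p1 j p2 k g x <= B i j k.
Proof.
move=> tot0 lein lejn lekn.
pose V i j k := box3 p0 i p1 j p2 k g x.
pose I := ('I_n.+1 * 'I_n.+1 * 'I_n.+1)%type.
pose Phi (z : I) := V z.1.1 z.1.2 z.2 - B z.1.1 z.1.2 z.2.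
pose z0 : I := (inord i, inord j, inord k).
have [[[a b] c] _ zmax] := @Order.TotalTheory.arg_maxP _ _ _ z0 xpredT Phi isT.
suff : Phi (a, b, c) <= 0.
  have := zmax z0 isT; rewrite /Phi /= !inordK// /V; lra.
rewrite leNgt; apply/negP; rewrite /Phi/=.
have {}zmax i' j' k' : (i' <= n)%N -> (j' <= n)%N -> (k' <= n)%N ->
    V i' j' k' - B i' j' k' <= V a b c - B a b c.
  by move=> ? ? ?; have := zmax (inord i', inord j', inord k') isT; rewrite /Phi /= !inordK.
move: (ltn_ord a) (ltn_ord b) (ltn_ord c) zmax; rewrite !ltnS.
case: a => [a /= _]; case: b => [b /= _]; case: c => [c /= _].
(* For a box with an empty side the box sum and the barrier both vanish. *)
case: a => [|a]; first by rewrite /V /B /box3 box_sum0 => ? ? ? ?; lra.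
case: b => [|b]; first by rewrite /V /B box3_swap12 /box3 box_sum0 => ? ? ? ?; lra.
case: c => [|c]; first by rewrite /V /B box3_swap23 box3_swap12 /box3 box_sum0 => ? ? ? ?; lra.
move=> lan lbn lcn zmax pos.
have step0 : (a.+1 < n)%N -> V a.+2 b.+1 c.+1 + V a b.+1 c.+1 - 2 * V a.+1 b.+1 c.+1
    <= - (2 * C * (b.+1%:R * c.+1%:R)).
  move=> lt; have := zmax a.+2 b.+1 c.+1 lt lbn lcn.
  have := zmax a b.+1 c.+1 (ltnW lan) lbn lcn.
  rewrite /B -(natr1 a.+1) -(natr1 a); lra.
have step1 : (b.+1 < n)%N -> V a.+1 b.+2 c.+1 + V a.+1 b c.+1 - 2 * V a.+1 b.+1 c.+1
    <= - (2 * C * (a.+1%:R * c.+1%:R)).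
  move=> lt; have := zmax a.+1 b.+2 c.+1 lan lt lcn.
  have := zmax a.+1 b c.+1 lan (ltnW lbn) lcn.
  rewrite /B -(natr1 b.+1) -(natr1 b); lra.
have step2 : (c.+1 < n)%N -> V a.+1 b.+1 c.+2 + V a.+1 b.+1 c - 2 * V a.+1 b.+1 c.+1
    <= - (2 * C * (a.+1%:R * b.+1%:R)).
  move=> lt; have := zmax a.+1 b.+1 c.+2 lan lbn lt.
  have := zmax a.+1 b.+1 c lan lbn (ltnW lcn).
  rewrite /B -(natr1 c.+1) -(natr1 c); lra.
have d0 : box3 p0 a.+1 p1 b.+1 p2 c.+1 (fun y => snd_diff p0 g y + - fst_diff p0 f0 y) x <=
    if (a.+1 < n)%N then - ((2 * C - 8 * F) * (b.+1%:R * c.+1%:R)) else 0.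
  by apply: box3_direction => //; apply: gP; rewrite !inE eqxx.
have d1 : box3 p0 a.+1 p1 b.+1 p2 c.+1 (fun y => snd_diff p1 g y + - fst_diff p1 f1 y) x <=
    if (b.+1 < n)%N then - ((2 * C - 8 * F) * (a.+1%:R * c.+1%:R)) else 0.
  rewrite box3_swap12; apply: box3_direction => //.
    by apply: gP; rewrite !inE eqxx orbT.
  by move=> lt; rewrite !(box3_swap12 p1 _ p0); exact: step1.
have d2 : box3 p0 a.+1 p1 b.+1 p2 c.+1 (fun y => snd_diff p2 g y + - fst_diff p2 f2 y) x <=
    if (c.+1 < n)%N then - ((2 * C - 8 * F) * (a.+1%:R * b.+1%:R)) else 0.
  rewrite -box3_rot; apply: box3_direction => //.
    by apply: gP; rewrite !inE eqxx !orbT.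
  by move=> lt; rewrite !(box3_rot p2 _ p0); exact: step2.
(* The three directions together are at least [- 8 e] times the product of the half-sides. One
   half-side below [n] contradicts this, and at the corner [(n, n, n)] the box sum and the barrier
   are both 0. *)
have := @box3_ge p0 a.+1 p1 b.+1 p2 c.+1 _ x _ Hlap; rewrite !box3D.
have n0 : 0 < n%:R :> R by rewrite ltr0n; apply: leq_trans lan.
have A0 : 0 < a.+1%:R :> R by rewrite ltr0n.
have B0 : 0 < b.+1%:R :> R by rewrite ltr0n.
have C0 : 0 < c.+1%:R :> R by rewrite ltr0n.
have An : a.+1%:R <= n%:R :> R by rewrite ler_nat.
have Bn : b.+1%:R <= n%:R :> R by rewrite ler_nat.
have Cn : c.+1%:R <= n%:R :> R by rewrite ler_nat.
have key (u v w : R) : 0 < u -> 0 < v -> 0 < w -> u <= n%:R ->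
    8 * e * (u * v * w) < (2 * C - 8 * F) * (v * w).
  move=> u0 v0 w0 un; have -> : 8 * e * (u * v * w) = (8 * e * u) * (v * w) by ring.
  rewrite ltr_pM2r ?mulr_gt0//; have : e * u <= e * n%:R by exact: ler_wpM2l.
  by have := HC; lra.
have K0 : 0 < 2 * C - 8 * F.
  by have := mulr_ge0 e0 (ltW n0); have := HC; lra.
have k0 := key _ _ _ A0 B0 C0 An; have k1 := key _ _ _ B0 A0 C0 Bn.
have k2 := key _ _ _ C0 A0 B0 Cn.
have P0 := mulr_gt0 K0 (mulr_gt0 B0 C0).
have P1 := mulr_gt0 K0 (mulr_gt0 A0 C0).
have P2 := mulr_gt0 K0 (mulr_gt0 A0 B0).
move: d0 d1 d2; rewrite !box3D.
case: ifPn => [_|la]; case: ifPn => [_|lb]; case: ifPn => [_|lc]; try lra.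
have ea : a.+1 = n by apply/eqP; rewrite eqn_leq lan leqNgt.
have eb : b.+1 = n by apply/eqP; rewrite eqn_leq lbn leqNgt.
have ec : c.+1 = n by apply/eqP; rewrite eqn_leq lcn leqNgt.
by move: pos; rewrite ea eb ec /V tot0 /B; lra.
Qed.

End barrier.

End box_sums.

(** * The Poisson equation with a divergence right-hand side *)

Section poisson.
Context {R : realType}.
Notation E := 'rV[R]_3.

Lemma shift_periodic_derive {W : normedModType R} (g : E -> W) v :
  shift_periodic g -> shift_periodic ('D_v g).
Proof.
move=> gP i x; rewrite /derive.
have -> // : (fun h : R => h^-1 *: ((g \o shift (x + 'e_i)) (h *: v) - g (x + 'e_i))) =
  (fun h => h^-1 *: ((g \o shift x) (h *: v) - g x)).
by apply/funext => h /=; rewrite addrA !gP.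
Qed.

Lemma unif_continuous_periodic_fin {I : finType} (g : I -> E -> R) (e : R) :
  (forall i, continuous (g i)) -> (forall i, shift_periodic (g i)) -> 0 < e ->
  exists2 d, 0 < d & forall i x z, `|z| < d -> `|g i (x + z) - g i x| <= e.
Proof.
move=> cg gP e0.
have /choice[d dP] : forall i, exists d, 0 < d /\
    forall x z, `|z| < d -> `|g i (x + z) - g i x| <= e.
  by move=> i; have [d ? ?] := unif_continuous_periodic (cg i) (gP i) e0; exists d.
exists (\big[Num.min/1]_i d i).
  by apply: lt_bigmin => // i _; have [] := dP i.
move=> i x z zd; have [_] := dP i; apply; apply: lt_le_trans zd _.
exact: bigmin_le.
Qed.

Lemma box_sum_translate {T : zmodType} p i (g : T -> R) x q :
  box_sum p i g (x + q) = box_sum p i (fun y => g (y + q)) x.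
Proof. by apply: eq_bigr => k _; rewrite !(addrAC x q). Qed.

Lemma box_sum1 {T : zmodType} p (g : T -> R) x : box_sum p 1 g x = g x + g (x - p).
Proof. by rewrite box_sumS box_sum0 add0r mulr0n addr0 mulr1n. Qed.

(** Because of the asymmetric range, the box of half-sides 1 consists of [x] and its translates by
    [- p0], [- p1], [- p2] and their sums. *)
Lemma box3_unit_ge {T : zmodType} p0 p1 p2 (g : T -> R) x (c : R) :
  (forall a0 a1 a2 : bool, c <= g (x - p0 *+ a0 - p1 *+ a1 - p2 *+ a2)) ->
  8 * c <= box3 p0 1 p1 1 p2 1 g x.
Proof.
move=> H; rewrite /box3 !box_sum1.
have := H true true true; have := H true true false.
have := H true false true; have := H true false false.
have := H false true true; have := H false true false.
have := H false false true; have := H false false false.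
rewrite /= !(mulr0n, mulr1n, subr0); lra.
Qed.

(** Subtracting the mean [m] of [g] over the full box makes the total vanish, as the barrier
    requires, and changes no difference. The barrier at [(1, 1, 1)] is [3 n C - 3 C]. *)
Lemma box3_unit_le {T : zmodType} (p0 p1 p2 : T) (f0 f1 f2 g : T -> R) n (F e C : R) :
  (0 < n)%N ->
  (forall p, p \in [:: p0; p1; p2] -> forall y, g (y + p *+ n.*2) = g y) ->
  (forall y, f0 (y + p0 *+ n.*2) = f0 y) ->
  (forall y, f1 (y + p1 *+ n.*2) = f1 y) ->
  (forall y, f2 (y + p2 *+ n.*2) = f2 y) ->
  (forall y, `|f0 y| <= F) -> (forall y, `|f1 y| <= F) -> (forall y, `|f2 y| <= F) ->
  0 <= e -> (forall y, - e <=
    (snd_diff p0 g y + - fst_diff p0 f0 y) + (snd_diff p1 g y + - fst_diff p1 f1 y)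
    + (snd_diff p2 g y + - fst_diff p2 f2 y)) ->
  4 * F + 4 * e * n%:R < C ->
  forall x, box3 p0 1 p1 1 p2 1 g x <=
    box3 p0 n p1 n p2 n g x / n%:R ^+ 3 + 3 * n%:R * C.
Proof.
move=> n0 gP f0P f1P f2P f0F f1F f2F e0 Hlap HC x.
have n0' : 0 < n%:R :> R by rewrite ltr0n.
set S := box3 p0 n p1 n p2 n g x.
pose m := S / (8 * n%:R ^+ 3).
have F0 : 0 <= F by apply: le_trans (f0F x).
have C0 : 0 <= C by have := mulr_ge0 e0 (ltW n0'); lra.
have := @box3_le_barrier R T p0 p1 p2 f0 f1 f2 (fun y => g y + - m) n F e C.
move=> /(_ _ f0P f1P f2P f0F f1F f2F e0 _ HC x 1%N 1%N 1%N _ n0 n0 n0).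
rewrite !box3D !box3N !box3_cst -/S.
have -> : 8 * n%:R * n%:R * n%:R * m = S by rewrite /m; field; rewrite gt_eqF.
have -> : S / n%:R ^+ 3 = 8 * m by rewrite /m; field; rewrite gt_eqF.
have sd p y : snd_diff p (fun y => g y + - m) y = snd_diff p g y.
  by rewrite /snd_diff; ring.
move=> H; have {H} := H _ _ (subrr _).
have : (forall p : T, p \in [:: p0; p1; p2] -> forall y : T, g (y + p *+ n.*2) - m = g y - m).
  by move=> p pin y; rewrite gP.
move=> A /(_ A); have B : forall y, - e <=
    (snd_diff p0 (fun y => g y + - m) y + - fst_diff p0 f0 y) + (snd_diff p1 (fun y => g y + - m) y + - fst_diff p1 f1 y)
    + (snd_diff p2 (fun y => g y + - m) y + - fst_diff p2 f2 y).
  by move=> y; rewrite !sd.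
move=> /(_ B); lra.
Qed.

Lemma sum3_dist (A0 A1 A2 B0 B1 B2 a0 a1 a2 b0 b1 b2 q : R) :
  `|A0 - a0| <= 2 * q -> `|A1 - a1| <= 2 * q -> `|A2 - a2| <= 2 * q ->
  `|B0 - b0| <= q -> `|B1 - b1| <= q -> `|B2 - b2| <= q ->
  a0 + a1 + a2 = b0 + b1 + b2 ->
  `|(A0 + - B0) + (A1 + - B1) + (A2 + - B2)| <= 9 * q.
Proof.
rewrite !ler_norml => /andP[? ?] /andP[? ?] /andP[? ?] /andP[? ?] /andP[? ?] /andP[? ?] ?.
by apply/andP; split; lra.
Qed.

Section oscillation.
Variables (g : E -> R) (f : 'I_3 -> E -> R) (F : R).
Hypotheses (gP : shift_periodic g) (cg : continuous g)
  (dg : forall d y, derivable g y 'e_d)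
  (ddg : forall d y, derivable ('D_('e_d) g) y 'e_d)
  (cddg : forall d, continuous ('D_('e_d) ('D_('e_d) g))).
Hypotheses (fP : forall d, shift_periodic (f d))
  (df : forall d y, derivable (f d) y 'e_d)
  (cdf : forall d, continuous ('D_('e_d) (f d)))
  (fF : forall d y, `|f d y| <= F).
Hypothesis lapg : forall y,
  \sum_d 'D_('e_d) ('D_('e_d) g) y = \sum_d 'D_('e_d) (f d) y.

(** For a mesh of size [h], [C] is close to [4 h F] and [n h = 1 / 2], so the bound [3 n C] is close
    to [6 F]. Shared among the eight points of the unit box, it lets [g] exceed its mean by about
    [3 / 4 F]; the same for [- g] gives the other half. *)
Lemma poisson_osc x y : g x - g y <= 3 / 2 * F.
Proof.
apply/ler_addgt0Pr => eta eta0.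
(* The two box estimates cost [73 / 8 e] together and the passage from [y] to the mesh costs [e],
   less than [20 e] in total. *)
set e := eta / 20; have e0 : 0 < e by rewrite /e; lra.
have [d1 d10 D1] := unif_continuous_periodic cg gP e0.
have [d2 d20 D2] := unif_continuous_periodic_fin cddg
  (fun d => shift_periodic_derive _ (shift_periodic_derive _ gP)) e0.
have [d3 d30 D3] := unif_continuous_periodic_fin cdf
  (fun d => shift_periodic_derive _ (fP d)) e0.
set d := Num.min d1 (Num.min d2 d3).
have d0 : 0 < d by rewrite !lt_min d10 d20 d30.
have dd1 : d <= d1 by rewrite ge_min lexx.
have dd2 : d <= d2 by rewrite !ge_min lexx orbT.
have dd3 : d <= d3 by rewrite !ge_min lexx !orbT.
set n := (Num.bound d^-1).+1.
have nd : d^-1 < n%:R.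
  apply: lt_trans (archi_boundP _) _; first by rewrite invr_ge0 ltW.
  by rewrite ltr_nat.
have n0 : 0 < n%:R :> R by rewrite ltr0n.
(* A period consists of [2 n] steps, so that the box of half-side [n] is the whole torus. *)
set h : R := (n.*2%:R)^-1.
have N0 : 0 < n.*2%:R :> R by rewrite ltr0n double_gt0.
have h0 : 0 < h by rewrite invr_gt0.
have nh : n%:R * h = 1 / 2.
  by rewrite /h -muln2 natrM; field; rewrite gt_eqF.
have hd : h < d.
  rewrite -ltf_pV2 ?posrE// invrK; apply: lt_trans nd _.
  by rewrite ltr_nat -addnn -{1}[n]addn0 ltn_add2l.
pose p (i : 'I_3) : E := h *: 'e_i.
have pn i : p i *+ n.*2 = 'e_i.
  by rewrite -scaler_nat scalerA mulfV ?scale1r ?gt_eqF.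
have ek (k : R) (i : 'I_3) : `|k| < d -> `|k *: ('e_i : E)| < d.
  move=> kd; apply: norm_rV_lt => j; rewrite !mxE eqxx /=.
  by case: eqP => _; rewrite ?mulr1// mulr0 normr0.
pose L2 (i : 'I_3) z := 'D_('e_i) ('D_('e_i) g) z.
pose L1 (i : 'I_3) z := 'D_('e_i) (f i) z.
have snd_e i z : `|snd_diff (p i) g z - h ^+ 2 * L2 i z| <= 2 * (h ^+ 2 * e).
  rewrite [leRHS]mulrA; apply: snd_taylor; [exact: ltW|exact: dg|exact: ddg|move=> k kh].
  by apply: D2; apply: lt_le_trans (ek _ _ _) dd2; apply: le_lt_trans kh hd.
have fst_e i z : `|fst_diff (p i) (fun y => h * f i y) z - h ^+ 2 * L1 i z| <= h ^+ 2 * e.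
  have := @fst_taylor R (f i) z 'e_i h e (ltW h0) (@df i) _.
  rewrite /fst_diff expr2 -!mulrBr -!mulrA -!mulrBr normrM (ger0_norm (ltW h0)) => H.
  apply: ler_wpM2l; first exact: ltW.
  apply: H => k /andP[k0 kh]; apply: D3; apply: lt_le_trans (ek _ _ _) dd3.
  by rewrite ger0_norm// (le_lt_trans kh).
(* The flux needs [4 h F]; the error [9 h ^ 2 e] of the discrete equation needs [18 h e], as
   [n h = 1 / 2]; the last [h e] makes [HC] strict. *)
pose C := h * (4 * F + 19 * e).
have e'0 : 0 <= 9 * h ^+ 2 * e by rewrite mulr_ge0 ?(ltW e0)// mulr_ge0// sqr_ge0.
have HC : 4 * (h * F) + 4 * (9 * h ^+ 2 * e) * n%:R < C.
  have -> : 4 * (9 * h ^+ 2 * e) * n%:R = 36 * (n%:R * h) * (h * e) by ring.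
  rewrite nh /C; have := mulr_gt0 h0 e0; lra.
have gper : forall q, q \in [:: p 0; p 1; p 2%:R] -> forall z, g (z + q *+ n.*2) = g z.
  by move=> q; rewrite !inE => /or3P[] /eqP-> z; rewrite pn gP.
have fF' i z : `|h * f i z| <= h * F.
  by rewrite normrM (ger0_norm (ltW h0)) ler_wpM2l ?(ltW h0).
have sum3 (G : 'I_3 -> R) : \sum_i G i = G 0 + G 1 + G 2%:R.
  rewrite !big_ord_recl big_ord0 addr0 addrA; congr (G _ + G _ + G _); exact: val_inj.
have lap z : h ^+ 2 * L2 0 z + h ^+ 2 * L2 1 z + h ^+ 2 * L2 2%:R z =
    h ^+ 2 * L1 0 z + h ^+ 2 * L1 1 z + h ^+ 2 * L1 2%:R z.
  have lz : \sum_i L2 i z = \sum_i L1 i z by exact: lapg.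
  by rewrite -!mulrDr -(sum3 (L2^~ z)) -(sum3 (L1^~ z)) lz.
have bound (s : R) : `|s| = 1 -> forall z,
    8 * (s * g z - e) <= s * box3 (p 0) n (p 1) n (p 2%:R) n g z / n%:R ^+ 3 + 3 * n%:R * C.
  move=> s1 z.
  have sE (G : E -> R) i j k w : box3 (p 0) i (p 1) j (p 2%:R) k (fun y => s * G y) w
      = s * box3 (p 0) i (p 1) j (p 2%:R) k G w.
    have /eqP := s1; rewrite eqr_norml ler01 andbT => /orP[] /eqP->.
      by rewrite mul1r; apply: eq_box3 => ?; rewrite mul1r.
    by rewrite mulN1r -box3N; apply: eq_box3 => ?; rewrite mulN1r.
  rewrite -sE; apply: le_trans (@box3_unit_le E (p 0) (p 1) (p 2%:R)
    (fun y => s * (h * f 0 y)) (fun y => s * (h * f 1 y)) (fun y => s * (h * f 2%:R y))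
    (fun y => s * g y) n (h * F) (9 * h ^+ 2 * e) C _ _ _ _ _ _ _ _ _ _ _ z) => //.
  - apply: box3_unit_ge => a0 a1 a2.
    have : `|g (z - p 0 *+ a0 - p 1 *+ a1 - p 2%:R *+ a2) - g z| <= e.
      rewrite -!addrA -!opprD; apply: D1; rewrite normrN; apply: lt_le_trans dd1.
      apply: norm_rV_lt => j; apply: le_lt_trans hd.
      rewrite 2![(_ + _ : E) _ _]mxE /p.
      have K (a : bool) (i : 'I_3) : ((h *: ('e_i : E)) *+ a) 0 j = h * (a && (j == i))%:R.
        by case: a; rewrite ?mulr0n ?mulr1n !mxE ?mulr0//= .
      rewrite !K -!mulrDr normrM (ger0_norm (ltW h0)) ler_piMr ?(ltW h0)//.
      case: j {K} => -[|[|[|//]]] ? /=; case: a0 a1 a2 => -[] [] /=;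
        rewrite ?(addr0, add0r) ?normr0 ?normr1//.
    set G := g _ => HG; have : `|s * (G - g z)| <= e by rewrite normrM s1 mul1r.
    by rewrite mulrBr ler_norml => /andP[A _]; lra.
  - by move=> q /gper H w; rewrite H.
  - by move=> w; rewrite pn fP.
  - by move=> w; rewrite pn fP.
  - by move=> w; rewrite pn fP.
  - by move=> w; rewrite normrM s1 mul1r.
  - by move=> w; rewrite normrM s1 mul1r.
  - by move=> w; rewrite normrM s1 mul1r.
  - move=> w.
    have sd q : snd_diff q (fun y => s * g y) w = s * snd_diff q g w by rewrite /snd_diff; ring.
    have fd q G : fst_diff q (fun y => s * (h * G y)) w = s * fst_diff q (fun y => h * G y) w by rewrite /fst_diff; ring.
    have sB (a c : R) : s * a + - (s * c) = s * (a + - c) by ring.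
    rewrite !sd !fd !sB -!mulrDr.
    set X := (X in s * X).
    have : `|X| <= 9 * h ^+ 2 * e.
      by rewrite -mulrA; exact: (sum3_dist (snd_e 0 w) (snd_e 1 w) (snd_e 2%:R w)
        (fst_e 0 w) (fst_e 1 w) (fst_e 2%:R w) (lap w)).
    move=> HX; have : `|s * X| <= 9 * h ^+ 2 * e by rewrite normrM s1 mul1r.
    by rewrite ler_norml => /andP[].
(* A point [y'] of the mesh through [x] lies close to [y]. The full box sums at [x] and at [y']
   agree, so the mean drops out of the difference of the two estimates. *)
have [m ym] : exists m : 'I_3 -> int, `|y - (x + (p 0 *~ m 0 + p 1 *~ m 1 + p 2%:R *~ m 2%:R))| < d.
  pose m i := Num.floor ((y - x) 0 i / h).
  exists m; apply: norm_rV_lt => j; apply: le_lt_trans hd.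
  have K (i : 'I_3) : (p i *~ m i) 0 j = (j == i)%:R * ((m j)%:~R * h).
    rewrite -scaler_int !mxE eqxx/=; case: eqP => [->|_]; first by rewrite mulr1 mul1r.
    by rewrite !mulr0 mul0r.
  have -> : (y - (x + (p 0 *~ m 0 + p 1 *~ m 1 + p 2%:R *~ m 2%:R))) 0 j
     = (y - x) 0 j - (m j)%:~R * h.
    rewrite opprD addrA mxE; congr (_ + _); rewrite mxE; congr (- _).
    rewrite 2![(_ + _ : E) _ _]mxE !K -!mulrDl.
    by case: j {K} => -[|[|[|//]]] ? /=; rewrite ?(addr0, add0r) mul1r.
  have := ge_floor ((y - x) 0 j / h); have := floorD1_gt ((y - x) 0 j / h).
  rewrite ler_pdivlMr// ltr_pdivrMr// -/(m j) intrD => A B.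
  by rewrite ler_norml; apply/andP; split; lra.
set y' := x + _ in ym.
pose tot := box3 (p 0) n (p 1) n (p 2%:R) n g.
have totP z : tot (z + p 0) = tot z /\ tot (z + p 1) = tot z /\ tot (z + p 2%:R) = tot z.
  have pe (i' : 'I_3) w : g (w + p i' *+ n.*2) = g w by rewrite pn gP.
  have pe' (i' : 'I_3) q k q' k' w : box_sum q k (box_sum q' k' g) (w + p i' *+ n.*2) = box_sum q k (box_sum q' k' g) w.
    by rewrite box_sum_translate; apply: eq_box_sum => y0; rewrite box_sum_translate; apply: eq_box_sum => y1.
  have Hi (i' : 'I_3) q q' w : box3 (p i') n q n q' n g (w + p i') = box3 (p i') n q n q' n g w.
    exact: box_sum_shift.
  rewrite /tot; split; first exact: Hi.
  by split; [rewrite !(box3_swap12 (p 0)) | rewrite -!(box3_rot (p 2%:R) n (p 0))]; exact: Hi.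
have toty : tot y' = tot x.
  rewrite /y' addrA addrA (shift_int_invariant (fun z => (totP z).2.2)).
  by rewrite (shift_int_invariant (fun z => (totP z).2.1)) (shift_int_invariant (fun z => (totP z).1)).
have := bound 1 (normr1 _) x; have := bound (- 1) (normrN1 _) y'.
rewrite -/tot toty.
have nC : 3 * n%:R * C = 3 * (n%:R * h) * (4 * F + 19 * e) by rewrite /C; ring.
rewrite nC nh.
set S := tot x.
have -> : -1 * S / n%:R ^+ 3 = - (1 * S / n%:R ^+ 3) by ring.
set S' := 1 * S / _.
have := D1 y' _ (lt_le_trans ym dd1); rewrite (addrC y') subrK ler_norml => /andP[A B].
have E : eta = 20 * e by rewrite /e; field.
lra.
Qed.

End oscillation.

End poisson.

(** * Doubling of variables *)

Section doubling_tools.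
Context {R : realType}.
Notation E := 'rV[R]_3.

Lemma within_comp_sub {X Y Z : topologicalType} (A : set X) (B : set Y)
    (f : X -> Y) (g : Y -> Z) :
  (forall x, A x -> B (f x)) -> continuous f -> {within B, continuous g} ->
  {within A, continuous (g \o f)}.
Proof.
move=> AB cf /subspace_continuousP cg; apply/subspace_continuousP => x Ax.
apply: (@cvg_comp _ _ _ f g _ (within B (nbhs (f x)))); last exact: cg (AB _ Ax).
move=> P BP.
have BP' : nbhs x (fun y => B (f y) -> P (f y)) by exact: (cf x _ BP).
have : nbhs x (fun y => A y -> P (f y)).
  by apply: (@filterS _ (nbhs x) _ (fun y => B (f y) -> P (f y)) (fun y => A y -> P (f y)) _ BP') => y H /AB.
by [].
Qed.

(** A cone touching from above bounds the derivative without determining it; this is the first order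
    condition where the penalty has a kink. *)
Lemma derive_abs_le {V : normedModType R} (f : V -> R) (x v : V) (a d : R) :
  0 < d -> derivable f x v ->
  (forall h, `|h| < d -> f (h *: v + x) <= f x + a * `|h|) -> `|'D_v f x| <= a.
Proof.
move=> d0 df fle; rewrite leNgt; apply/negP => lt_a.
set L := 'D_v f x in lt_a *; set e := (`|L| - a) / 2.
have e0 : 0 < e by rewrite /e; lra.
have [d1 d10 H1] := derive_approx df e0.
have m0 : 0 < Num.min d d1 by rewrite lt_min d0 d10.
have md : Num.min d d1 <= d by rewrite ge_min lexx.
have md1 : Num.min d d1 <= d1 by rewrite ge_min lexx orbT.
set k := Num.min d d1 / 2.
have k0 : 0 < k by rewrite /k; lra.
have [h [hk hL]] : exists h, `|h| = k /\ L * h = `|L| * k.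
  have [L0|L0] := leP 0 L.
    by exists k; rewrite (gtr0_norm k0) (ger0_norm L0).
  by exists (- k); rewrite normrN (gtr0_norm k0) (ltr0_norm L0) mulrN mulNr.
have hd : `|h| < d by rewrite hk /k; lra.
have := H1 h; rewrite hk k0 /= => /(_ _)/wrap[]; first by rewrite /k; lra.
rewrite -/L hL ler_norml => /andP[A _].
have := fle h hd; rewrite hk => B.
have : 0 < e * k by exact: mulr_gt0.
have E2 : e * k = (`|L| * k - a * k) / 2 by rewrite /e; ring.
lra.
Qed.

Lemma derive_translate {V W : normedModType R} (f : V -> W) (z x v : V) :
  'D_v (fun y => f (y + z)) x = 'D_v f (x + z).
Proof.
rewrite /derive.
by have -> // : (fun h : R => h^-1 *: (((fun y => f (y + z)) \o shift x) (h *: v) - f (x + z)))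
  = (fun h => h^-1 *: ((f \o shift (x + z)) (h *: v) - f (x + z)));
  apply/funext => h /=; rewrite addrA.
Qed.

Lemma derivable_translate {V W : normedModType R} (f : V -> W) (z x v : V) :
  derivable f (x + z) v -> derivable (fun y => f (y + z)) x v.
Proof.
rewrite /derivable.
by have -> // : (fun h : R => h^-1 *: (((fun y => f (y + z)) \o shift x) (h *: v) - f (x + z)))
  = (fun h => h^-1 *: ((f \o shift (x + z)) (h *: v) - f (x + z)));
  apply/funext => h /=; rewrite addrA.
Qed.

Lemma derivable_increment {V W : normedModType R} (f : V -> W) (z x v : V) :
  (forall y, derivable f y v) -> derivable (fun y => f (y + z) - f y) x v.
Proof. by move=> df; apply: derivableB => //; exact: derivable_translate. Qed.

Lemma derive_increment {V W : normedModType R} (f : V -> W) (z x v : V) :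
  (forall y, derivable f y v) ->
  'D_v (fun y => f (y + z) - f y) x = 'D_v f (x + z) - 'D_v f x.
Proof.
move=> df; rewrite -(derive_translate f z x v) -deriveB//.
exact: derivable_translate.
Qed.

End doubling_tools.

Section arithmetic.
Context {R : realType}.

Lemma ler_sub_bound (p q r : R) : `|p| <= r -> `|q| <= r -> p - q <= 2 * r.
Proof. by rewrite !ler_norml => /andP[? ?] /andP[? ?]; lra. Qed.

Lemma time_touch (p q S m t s s0 p0 q0 : R) :
  p - q - S - m * (t - s) <= p0 - q0 - S - m * (t - s0) ->
  p - q <= p0 - q0 + (- m) * (s - s0).
Proof. lra. Qed.

(** The difference of the two equations is at most [2 F], while its terms add up to at least
    [- m - 6 B a + 2 c = 2 F + m]. This balance dictates the value of [c]. *)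
Lemma balance_contra (d1 d2 s1 s2 l1 l2 F m c B a : R) :
  `|d1 + s1 - 2^-1 * l1| <= F -> `|d2 + s2 - 2^-1 * l2| <= F ->
  l1 - l2 <= - (4 * c) -> s2 - s1 <= 6 * B * a -> - m <= d1 - d2 -> 0 < m ->
  c = 3 * B * a + F + m -> False.
Proof. by rewrite !ler_norml => /andP[? ?] /andP[? ?]; lra. Qed.

End arithmetic.

Section doubling.
Context {R : realType}.
Notation E := 'rV[R]_3.
Variables (u : R -> E -> R) (b : R -> E -> 'I_3 -> R) (T0 T1 B F M a : R).
Hypotheses (T01 : T0 < T1) (B0 : 0 <= B) (F0 : 0 <= F) (M0 : 0 < M) (a0 : 0 < a).
Hypothesis cu : {within [set z : R * E | T0 <= z.1 <= T1], continuous (fun z => u z.1 z.2)}.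
Hypothesis uP : forall s, T0 <= s <= T1 -> shift_periodic (u s).
Hypothesis dut : forall s x, T0 < s <= T1 -> derivable (u ^~ x) s 1.
Hypothesis du : forall s, T0 < s <= T1 -> forall k x, derivable (u s) x 'e_k.
Hypothesis ddu : forall s, T0 < s <= T1 -> forall k x, derivable ('D_('e_k) (u s)) x 'e_k.
Hypothesis eqn : forall s x, T0 < s <= T1 ->
  `|'D_1 (u ^~ x) s + \sum_k b s x k * 'D_('e_k) (u s) x
    - 2^-1 * \sum_k 'D_('e_k) ('D_('e_k) (u s)) x| <= F.
Hypothesis bB : forall s x k, T0 < s <= T1 -> `|b s x k| <= B.
Hypothesis uM : forall s x y, T0 <= s <= T1 -> u s x - u s y <= M.

Let c := 3 * B * a + F + M / (T1 - T0).
(** Says that [M] is at most [a ^ 2 / (4 c)], the value of the penalty at its vertex. The condition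
    is implicit, since [c] contains [a]. *)
Hypothesis ac : 4 * M * c <= a ^+ 2.

Let tau0 : 0 < T1 - T0. Proof. by rewrite subr_gt0. Qed.
Let Mt0 : 0 < M / (T1 - T0). Proof. exact: divr_gt0. Qed.
Let c0 : 0 < c.
Proof.
have := mulr_ge0 B0 (ltW a0); have := Mt0; have := F0; rewrite /c; lra.
Qed.

Let r0 := a / (2 * c).
Let r00 : 0 < r0. Proof. by rewrite /r0 divr_gt0// mulr_gt0. Qed.
(* Increasing on [0, r0], with phi r0 >= M: a positive maximum of Phi below has
   all coordinates of the displacement smaller than r0. *)
Let phi (r : R) := a * r - c * r ^+ 2.

Let phi_r0 : M <= phi r0.
Proof.
have -> : phi r0 = a ^+ 2 / (4 * c).
  by rewrite /phi /r0; field; have := c0; lra.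
by rewrite ler_pdivlMr ?mulr_gt0// (mulrC 4) mulrA mulrAC (mulrC M) ac.
Qed.

Let cr0 : 2 * c * r0 = a.
Proof. by rewrite /r0; field; have := c0; lra. Qed.

Let phi_ge0 r : 0 <= r <= r0 -> 0 <= phi r.
Proof.
move=> /andP[r1 r2]; have -> : phi r = r * (a - c * r) by rewrite /phi; ring.
apply: mulr_ge0 => //; have : c * r <= c * r0 by rewrite ler_pM2l.
have := cr0; have := mulr_gt0 c0 r00; lra.
Qed.

(** The second point is given by its displacement from the first: periodicity then confines the
    first point to the unit cube while the displacement ranges over a fixed cube. The time term
    equals [M] at [T0], which excludes a positive maximum there, and vanishes at [T1]. *)
Let Phi (z : R * (E * E)) := u z.1 (z.2.1 + z.2.2) - u z.1 z.2.1
  - \sum_k phi `|z.2.2 0 k| - M / (T1 - T0) * (T1 - z.1).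

Let K : set (R * (E * E)) := `[T0, T1] `*` (cube 0 1 `*` cube (- r0) r0).

Let sum_phi_ge0 (z : E) : cube (- r0) r0 z -> 0 <= \sum_k phi `|z 0 k|.
Proof.
move=> zK; apply: sumr_ge0 => k _; apply: phi_ge0; rewrite normr_ge0/= ler_norml.
by have := zK k; rewrite in_itv.
Qed.

Let cPhi : {within K, continuous Phi}.
Proof.
have cphi : continuous (fun r : R => phi `|r|).
  move=> r; apply: cvgB; apply: cvgM; [exact: cvg_cst|exact: norm_continuous|exact: cvg_cst|].
  by rewrite expr2; apply: (@cvgM _ _ _ _ (fun r : R => `|r|) (fun r : R => `|r|)); exact: norm_continuous.
have ccoord (k : 'I_3) : continuous (fun z : R * (E * E) => phi `|z.2.2 0 k|).
  move=> z; apply: (@continuous_comp _ _ _ (fun z : R * (E * E) => z.2.2 0 k) (fun r : R => phi `|r|)); last exact: cphi.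
  apply: (@continuous_comp _ _ _ (fun z : R * (E * E) => z.2.2) (fun x : E => x 0 k)); last exact: coord_continuous.
  by apply: (@continuous_comp _ _ _ snd snd); exact: cvg_snd.
have csum : continuous (fun z : R * (E * E) => \sum_k phi `|z.2.2 0 k|).
  have -> : (fun z : R * (E * E) => \sum_k phi `|z.2.2 0 k|) = (fun z => 
      phi `|z.2.2 0 ord0| + (phi `|z.2.2 0 (lift ord0 ord0)| + phi `|z.2.2 0 (lift ord0 (lift ord0 ord0))|)).
    by apply/funext => z; rewrite !big_ord_recl big_ord0 addr0.
  by move=> z; apply: cvgD; [|apply: cvgD]; exact: ccoord.
have cT : continuous (fun z : R * (E * E) => M / (T1 - T0) * (T1 - z.1)).
  by move=> z; apply: cvgM; [exact: cvg_cst|apply: cvgB; [exact: cvg_cst|exact: cvg_fst]].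
have c1 : {within K, continuous (fun z : R * (E * E) => u z.1 (z.2.1 + z.2.2))}.
  apply: (@within_comp_sub _ _ _ K _ (fun z : R * (E * E) => (z.1, z.2.1 + z.2.2)) _ _ _ cu).
    by move=> z [/=]; rewrite in_itv.
  move=> z; apply: (@cvg_pair _ _ _ _ (nbhs z.1) (nbhs (z.2.1 + z.2.2))); first exact: cvg_fst.
  by apply: cvgD; apply: (@continuous_comp _ _ _ snd); [exact: cvg_snd|exact: cvg_fst|exact: cvg_snd|exact: cvg_snd].
have c2 : {within K, continuous (fun z : R * (E * E) => u z.1 z.2.1)}.
  apply: (@within_comp_sub _ _ _ K _ (fun z : R * (E * E) => (z.1, z.2.1)) _ _ _ cu).
    by move=> z [/=]; rewrite in_itv.
  move=> z; apply: (@cvg_pair _ _ _ _ (nbhs z.1) (nbhs z.2.1)); first exact: cvg_fst.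
  by apply: (@continuous_comp _ _ _ snd fst); [exact: cvg_snd|exact: cvg_fst].
move=> z; apply: cvgB; last exact: continuous_subspaceT cT z.
apply: cvgB; last exact: continuous_subspaceT csum z.
by apply: cvgB; [exact: c1|exact: c2].
Qed.

Section at_max.
Variables (s0 : R) (x0 z0 : E).
Hypotheses (s0K : T0 <= s0 <= T1) (z0K : cube (- r0) r0 z0).
Hypothesis Pos : 0 < Phi (s0, (x0, z0)).
Hypothesis Max : forall s x z, T0 <= s <= T1 -> cube (- r0) r0 z ->
  Phi (s, (x, z)) <= Phi (s0, (x0, z0)).

Let s0T0 : T0 < s0 <= T1.
Proof.
have /andP[s1 ->] := s0K; rewrite andbT lt_neqAle s1 andbT; apply/eqP => E0.
have := Pos; have := uM (x0 + z0) x0 s0K; have := sum_phi_ge0 z0K.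
rewrite /Phi/= -E0 divfK ?gt_eqF ?tau0//; lra.
Qed.

Let time_ge0 : 0 <= M / (T1 - T0) * (T1 - s0).
Proof. by rewrite mulr_ge0 ?(ltW Mt0)// subr_ge0; have /andP[] := s0K. Qed.

Let z0_lt k : `|z0 0 k| < r0.
Proof.
have zk i : `|z0 0 i| <= r0 by rewrite ler_norml; have := z0K i; rewrite in_itv.
rewrite lt_neqAle zk andbT; apply/eqP => E0.
have := Pos; rewrite /Phi /= (bigD1 k)//= E0.
have : 0 <= \sum_(i < 3 | i != k) phi `|z0 0 i|.
  by apply: sumr_ge0 => i _; apply: phi_ge0; rewrite normr_ge0 zk.
have := uM (x0 + z0) x0 s0K; have := time_ge0; have := phi_r0; lra.
Qed.

Let shift_sum (h : R) k : \sum_i phi `|(h *: 'e_k + z0) 0 i| - \sum_i phi `|z0 0 i|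
  = phi `|z0 0 k + h| - phi `|z0 0 k|.
Proof.
rewrite -[LHS]sumrB (bigD1 k)//= !mxE !eqxx mulr1 (addrC h) big1 ?addr0// => i ik.
by rewrite !mxE eqxx (negbTE ik) mulr0 add0r subrr.
Qed.

Let shift_cube (h : R) k : `|h| < r0 - `|z0 0 k| -> cube (- r0) r0 (h *: 'e_k + z0).
Proof.
move=> hr i; rewrite in_itv/= -ler_norml !mxE eqxx/=; case: eqP => [->|_].
  rewrite mulr1; apply: le_trans (ler_normD _ _) _; lra.
by rewrite mulr0 add0r; exact: ltW.
Qed.

Let step_far h k : `|h| < r0 - `|z0 0 k| ->
  u s0 (h *: 'e_k + (x0 + z0)) <= u s0 (x0 + z0) + (phi `|z0 0 k + h| - phi `|z0 0 k|).
Proof.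
move=> hr; have := Max x0 s0K (shift_cube hr); rewrite /Phi /= -shift_sum addrCA; lra.
Qed.

(** The displacement changes by [- h], so that the far point [x0 + z0] stays fixed. *)
Let step_near h k : `|h| < r0 - `|z0 0 k| ->
  - u s0 (h *: 'e_k + x0) <= - u s0 x0 + (phi `|z0 0 k - h| - phi `|z0 0 k|).
Proof.
rewrite -normrN => hr; have := Max (h *: 'e_k + x0) s0K (shift_cube hr).
rewrite /Phi /= -shift_sum.
have -> : h *: 'e_k + x0 + (- h *: 'e_k + z0) = x0 + z0.
  by rewrite scaleNr addrACA subrr add0r.
lra.
Qed.

Let step_sync h k :
  u s0 (h *: 'e_k + x0 + z0) - u s0 (h *: 'e_k + x0) <= u s0 (x0 + z0) - u s0 x0.
Proof. have := Max (h *: 'e_k + x0) s0K z0K; rewrite /Phi /=; lra. Qed.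

Let p k := 'D_('e_k) (u s0) (x0 + z0).
Let q k := 'D_('e_k) (u s0) x0.
Let pp k := 'D_('e_k) ('D_('e_k) (u s0)) (x0 + z0).
Let qq k := 'D_('e_k) ('D_('e_k) (u s0)) x0.

(* The two points are moved separately: each second derivative gains - 2 c. *)
Let sgn_case k : z0 0 k != 0 -> [/\ p k = q k, `|p k| <= a & pp k - qq k <= - (4 * c)].
Proof.
move=> zk0; set r := `|z0 0 k|.
have r0' : 0 < r by rewrite normr_gt0.
have rr0 : r < r0 := z0_lt k.
pose sg : R := Num.sg (z0 0 k).
have sgr : `|sg| = 1 by rewrite normr_sg zk0.
have sg2 : sg ^+ 2 = 1 by rewrite sqr_sg zk0.
have zr : z0 0 k = sg * r by rewrite /sg /r -numEsg.
have nz h : `|h| < r -> `|z0 0 k + h| = r + sg * h.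
  move=> hr; have -> : z0 0 k + h = sg * (r + sg * h) by rewrite zr mulrDr mulrA -expr2 sg2 mul1r.
  rewrite normrM sgr mul1r ger0_norm//.
  have : `|sg * h| < r by rewrite normrM sgr mul1r.
  by rewrite ltr_norml => /andP[]; lra.
set d := Num.min r (r0 - r).
have d0 : 0 < d by rewrite lt_min r0' subr_gt0.
have dr : d <= r by rewrite ge_min lexx.
have dr0 : d <= r0 - r by rewrite ge_min lexx orbT.
have [A1 A2] : p k = (a - 2 * c * r) * sg /\ pp k <= 2 * (- c).
  apply: (derive_le_quadratic d0) => [y||h hd]; [exact: du|exact: ddu|].
  apply: le_trans (step_far (lt_le_trans hd dr0)) _.
  rewrite -/r nz ?(lt_le_trans hd)// /phi.
  have -> : (r + sg * h) ^+ 2 = r ^+ 2 + 2 * r * sg * h + h ^+ 2.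
    transitivity (r ^+ 2 + 2 * r * sg * h + sg ^+ 2 * h ^+ 2); first by ring.
    by rewrite sg2 mul1r.
  lra.
have [B1 B2] : - q k = - (a - 2 * c * r) * sg /\ - qq k <= 2 * (- c).
  have dN : 'D_('e_k) (fun y => - u s0 y) = (fun y => - 'D_('e_k) (u s0) y).
    by apply/funext => y; rewrite deriveN//; exact: du.
  have dNN : 'D_('e_k) ('D_('e_k) (fun y => - u s0 y)) x0 = - qq k.
    by rewrite dN deriveN//; exact: ddu.
  rewrite -dNN /q -[X in X = _ /\ _](congr1 (@^~ x0) dN).
  apply: (derive_le_quadratic d0) => [y||h hd].
  - by apply: derivableN; exact: du.
  - by rewrite dN; apply: derivableN; exact: ddu.
  apply: le_trans (step_near (lt_le_trans hd dr0)) _.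
  rewrite -/r nz ?normrN ?(lt_le_trans hd)// /phi.
  have -> : (r + sg * - h) ^+ 2 = r ^+ 2 - 2 * r * sg * h + h ^+ 2.
    transitivity (r ^+ 2 - 2 * r * sg * h + sg ^+ 2 * h ^+ 2); first by ring.
    by rewrite sg2 mul1r.
  lra.
split; last lra.
  rewrite A1; have : q k = (a - 2 * c * r) * sg by lra.
  by [].
rewrite A1 normrM sgr mulr1 ger0_norm.
  have := mulr_gt0 c0 r0'; lra.
have : c * r <= c * r0 by rewrite ler_pM2l// ltW.
have := cr0; lra.
Qed.

(* phi is not differentiable at 0: both points are moved together, and the bound
   on the common derivative comes from moving one of them. *)
Let zero_case k : z0 0 k = 0 -> [/\ p k = q k, `|p k| <= a & pp k - qq k <= 0].
Proof.
move=> zk0.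
have dB : 'D_('e_k) (fun y => u s0 (y + z0) - u s0 y) =
    (fun y => 'D_('e_k) (u s0) (y + z0) - 'D_('e_k) (u s0) y).
  by apply/funext => y; apply: derive_increment => w; exact: du.
have dBB : 'D_('e_k) ('D_('e_k) (fun y => u s0 (y + z0) - u s0 y)) x0 = pp k - qq k.
  by rewrite dB; apply: derive_increment => w; exact: ddu.
have [A1 A2] : 'D_('e_k) (fun y => u s0 (y + z0) - u s0 y) x0 = 0 /\
    'D_('e_k) ('D_('e_k) (fun y => u s0 (y + z0) - u s0 y)) x0 <= 2 * 0.
  apply: (@derive_le_quadratic _ _ _ _ _ _ _ 1) => // [y||h hd].
  - by apply: derivable_increment => w; exact: du.
  - by rewrite dB; apply: derivable_increment => w; exact: ddu.
  by rewrite !mul0r !addr0; exact: step_sync.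
split; [| |by rewrite -dBB; move: A2; rewrite mulr0].
  apply/eqP; rewrite -subr_eq0; apply/eqP; apply: etrans A1; apply/esym.
  by apply: derive_increment => w; exact: du.
apply: (derive_abs_le r00); first exact: du.
move=> h hr; have := @step_far h k; rewrite zk0 normr0 subr0 add0r => /(_ hr).
rewrite /phi expr0n/= mulr0; have : 0 <= c * `|h| ^+ 2 by rewrite mulr_ge0 ?sqr_ge0// ltW.
lra.
Qed.

Lemma doubling_no_max : False.
Proof.
(* At displacement 0 [Phi] is not positive, so at least one coordinate yields the full gain
   [- 4 c]. *)
have [k1 zk1] : exists k, z0 0 k != 0.
  apply/existsP; rewrite -negb_forall; apply/negP => /forallP z00.
  have z0E : z0 = 0 by apply/rowP => k; rewrite mxE; apply/eqP.
  have := Pos; rewrite /Phi /= z0E addr0 subrr big1; last first.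
    by move=> i _; rewrite mxE normr0 /phi expr0n/= !mulr0 subrr.
  have := time_ge0; lra.
have all k : [/\ p k = q k, `|p k| <= a & pp k - qq k <= (if k == k1 then - (4 * c) else 0)].
  have [zk|zk] := eqVneq (z0 0 k) 0.
    have [? ? ?] := zero_case zk; split=> //.
    by case: eqP => // kk1; move: zk1; rewrite -kk1 zk eqxx.
  have [? ? ?] := sgn_case zk; split=> //; case: eqP => // _; have := c0; lra.
have lap_le : \sum_k pp k - \sum_k qq k <= - (4 * c).
  rewrite -sumrB; apply: (@le_trans _ _ (\sum_k (if k == k1 then - (4 * c) else 0))).
    by apply: ler_sum => k _; have [] := all k.
  by rewrite -big_mkcond/= big_pred1_eq.
(* Since the derivatives at the two points agree, only the size of [b] enters, not its variation:
   each coordinate costs at most [2 B a]. *)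
have drift : \sum_k b s0 x0 k * q k - \sum_k b s0 (x0 + z0) k * p k <= 6 * B * a.
  have -> : 6 * B * a = \sum_(k < 3) 2 * (B * a).
    by rewrite sumr_const card_ord -mulr_natl; ring.
  rewrite -sumrB; apply: ler_sum => k _; have [<- pa _] := all k.
  have bb y : `|b s0 y k * p k| <= B * a by rewrite normrM; apply: ler_pM => //; exact: bB.
  exact: ler_sub_bound.
have dU x : derivable (u ^~ x) s0 1 by exact: dut.
have tU : - (M / (T1 - T0)) <= 'D_1 (u ^~ (x0 + z0)) s0 - 'D_1 (u ^~ x0) s0.
  pose g := fun s : R => (u s0 (x0 + z0) - u s0 x0) + (- (M / (T1 - T0))) * (s - s0).
  have dg : is_derive s0 1 g (- (M / (T1 - T0))).
    by rewrite /g; apply: is_derive_eq; rewrite /GRing.scale /=; ring.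
  rewrite -deriveB// -(@derive_val _ _ _ _ _ _ _ dg).
  have s0d : 0 < s0 - T0 by rewrite subr_gt0; have /andP[] := s0T0.
  apply: (derive_le_touching s0d) => //.
  - exact: derivableB.
  - by rewrite /g subrr mulr0 addr0.
  move=> s /andP[]; rewrite subKr => s1 s2; have sK : T0 <= s <= T1.
    by rewrite (ltW s1) (le_trans (ltW s2))//; have /andP[] := s0K.
  exact: time_touch (Max x0 sK z0K).
exact: (balance_contra (eqn (x0 + z0) s0T0) (eqn x0 s0T0) lap_le drift tU Mt0 (erefl c)).
Qed.

End at_max.

Lemma lipschitz_doubling x y : u T1 x - u T1 y <= a * \sum_k `|x 0 k - y 0 k|.
Proof.
have T01' : T0 <= T1 by exact: ltW.
have T1K : T0 <= T1 <= T1 by rewrite T01' lexx.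
have KE z : cube (- r0) r0 z -> 0 < Phi (T1, (y, z)) -> False.
  move=> zK pos.
  have [m mP] := unit_cube_reduction y.
  have Phi_shift s x' z' m' : T0 <= s <= T1 -> Phi (s, (x' + lattice_vec m', z')) = Phi (s, (x', z')).
    by move=> sK; rewrite /Phi/= (addrAC x') !(shift_periodic_lattice _ _ (uP sK)).
  have K0 : K !=set0.
    exists (T1, (y + lattice_vec m, z)); split; first by rewrite /= in_itv/= T01' lexx.
    by split=> //= i; rewrite in_itv/=.
  have cK : compact K.
    apply: compact_setX; first exact: segment_compact.
    by apply: compact_setX; exact: compact_cube.
  have [[s0 [x0 z0]] /set_mem[/= s0K [x0K z0K]] mx] := compact_EVT_max K0 cK cPhi.
  have Max s x' z' : T0 <= s <= T1 -> cube (- r0) r0 z' -> Phi (s, (x', z')) <= Phi (s0, (x0, z0)).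
    move=> sK zK'; have [m' m'P] := unit_cube_reduction x'.
    rewrite -(Phi_shift _ _ _ m')//; apply: mx; rewrite inE; split; first by rewrite /= in_itv.
    by split=> //= i; rewrite in_itv/=.
  rewrite in_itv/= in s0K.
  by apply: (doubling_no_max s0K z0K (lt_le_trans pos (Max _ _ _ T1K zK)) Max).
pose z := x - y.
have sumE : \sum_k `|x 0 k - y 0 k| = \sum_k `|z 0 k|.
  by apply: eq_bigr => k _; rewrite !mxE.
rewrite sumE; have [zK|zK] := pselect (cube (- r0) r0 z).
  have : Phi (T1, (y, z)) <= 0 by rewrite leNgt; apply/negP => /(KE _ zK).
  have yz : y + z = x by rewrite /z addrC subrK.
  rewrite /Phi/= subrr mulr0 subr0 yz => H.
  rewrite mulr_sumr; apply: (@le_trans _ _ (\sum_k phi `|z 0 k|)); first by rewrite -subr_le0.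
  by apply: ler_sum => k _; rewrite /phi lerBlDr lerDl mulr_ge0 ?sqr_ge0// ltW//.
(* Outside the cube some coordinate of the displacement exceeds [r0], and [a r0 >= phi r0 >= M]
   already dominates the difference. *)
apply: le_trans (uM x y T1K) _.
have /existsNP[k] := zK; rewrite in_itv/= -ler_norml => /negP; rewrite -ltNge => rk.
rewrite (bigD1 k)//= mulrDr.
have : 0 <= a * \sum_(i < 3 | i != k) `|z 0 i|.
  by rewrite mulr_ge0 ?(ltW a0)// sumr_ge0.
have : a * r0 <= a * `|z 0 k| by rewrite ler_pM2l// ltW.
have : M <= a * r0.
  apply: le_trans phi_r0 _; rewrite /phi lerBlDr lerDl mulr_ge0 ?sqr_ge0// ltW//.
lra.
Qed.

End doubling.

(** * Euclidean and operator norms *)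

Section euclidean.
Context {R : realType}.
Notation E := 'rV[R]_3.
Implicit Types (x y e : E) (M : 'M[R]_3).

Definition dot e x : R := \sum_i e 0 i * x 0 i.

Lemma sum3E {V : nmodType} (F : 'I_3 -> V) :
  \sum_i F i = F ord0 + F (lift ord0 ord0) + F (lift ord0 (lift ord0 ord0)).
Proof. by rewrite !big_ord_recl big_ord0 addr0 addrA. Qed.

Lemma dot_delta i x : dot 'e_i x = x 0 i.
Proof.
rewrite /dot (bigD1 i)//= !mxE !eqxx mul1r big1 ?addr0// => j ji.
by rewrite !mxE eqxx (negbTE ji) mul0r.
Qed.

Lemma dotDr e x y : dot e (x + y) = dot e x + dot e y.
Proof. by rewrite /dot -big_split; apply: eq_bigr => i _; rewrite /= mxE mulrDr. Qed.

Lemma dotZr e a x : dot e (a *: x) = a * dot e x.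
Proof. by rewrite /dot mulr_sumr; apply: eq_bigr => i _; rewrite mxE; ring. Qed.

Lemma dotNr e x : dot e (- x) = - dot e x.
Proof. by rewrite -scaleN1r dotZr mulN1r. Qed.

Lemma dot_sumr e (F : 'I_3 -> E) : dot e (\sum_j F j) = \sum_j dot e (F j).
Proof. by rewrite !sum3E !dotDr. Qed.

Lemma euclid_ge0 x : 0 <= euclid x.
Proof. exact: sqrtr_ge0. Qed.

Lemma euclid_sqr x : euclid x ^+ 2 = \sum_i x 0 i ^+ 2.
Proof. by rewrite sqr_sqrtr// sumr_ge0// => i _; exact: sqr_ge0. Qed.

Lemma dotxx x : dot x x = euclid x ^+ 2.
Proof. by rewrite euclid_sqr; apply: eq_bigr => i _; rewrite expr2. Qed.

Lemma cauchy_schwarz e x : dot e x <= euclid e * euclid x.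
Proof.
apply: le_trans (ler_norm _) _.
rewrite -(@ler_pXn2r _ 2)// ?nnegrE ?mulr_ge0 ?euclid_ge0//.
rewrite real_normK ?num_real// exprMn !euclid_sqr /dot !sum3E.
set a := e 0 _; set b := e 0 _; set c := e 0 _; set p := x 0 _; set q := x 0 _; set r := x 0 _.
rewrite -subr_ge0 [X in 0 <= X](_ : _ = (a * q - b * p) ^+ 2 + (a * r - c * p) ^+ 2 + (b * r - c * q) ^+ 2); last by ring.
by rewrite !addr_ge0 ?sqr_ge0.
Qed.

Lemma euclidZ a x : euclid (a *: x) = `|a| * euclid x.
Proof.
apply/eqP; rewrite -(@eqrXn2 _ 2)// ?euclid_ge0 ?mulr_ge0 ?euclid_ge0//.
rewrite exprMn real_normK ?num_real// !euclid_sqr mulr_sumr; apply/eqP.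
by apply: eq_bigr => i _; rewrite mxE exprMn.
Qed.

Lemma euclid0 : euclid (0 : E) = 0.
Proof. by rewrite -(scale0r (0 : E)) euclidZ normr0 mul0r. Qed.

Lemma abs_coord_le_euclid x i : `|x 0 i| <= euclid x.
Proof.
rewrite -(@ler_pXn2r _ 2)// ?nnegrE ?euclid_ge0// real_normK ?num_real// euclid_sqr.
by rewrite (bigD1 i)//= lerDl sumr_ge0// => j _; exact: sqr_ge0.
Qed.

(** The factor 2 rounds up the square root of 3. *)
Lemma euclid_le x a : (forall i, `|x 0 i| <= a) -> euclid x <= 2 * a.
Proof.
move=> xa; have a0 : 0 <= a by apply: le_trans (xa 0).
rewrite -(@ler_pXn2r _ 2)// ?nnegrE ?euclid_ge0 ?mulr_ge0//.
have sq i : x 0 i ^+ 2 <= a ^+ 2.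
  by rewrite -(real_normK (num_real (x 0 i))) ler_pXn2r// nnegrE.
rewrite euclid_sqr sum3E exprMn.
have := sq ord0; have := sq (lift ord0 ord0); have := sq (lift ord0 (lift ord0 ord0)).
have := sqr_ge0 a; lra.
Qed.

Lemma euclid_eq0 x : euclid x = 0 -> x = 0.
Proof.
move=> x0; apply/rowP => i; rewrite mxE; apply/eqP; rewrite -normr_le0 -x0.
exact: abs_coord_le_euclid.
Qed.

Lemma continuous_euclid : continuous (@euclid R).
Proof.
move=> x; apply: (@continuous_comp _ _ _ (fun x : E => \sum_(i < 3) x 0 i ^+ 2) Num.sqrt); last exact: sqrt_continuous.
have -> : (fun x : E => \sum_(i < 3) x 0 i ^+ 2) = (fun x => x 0 ord0 ^+ 2 +
   x 0 (lift ord0 ord0) ^+ 2 + x 0 (lift ord0 (lift ord0 ord0)) ^+ 2).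
  by apply/funext => y; rewrite sum3E.
have sq (i : 'I_3) : continuous (fun x : E => x 0 i ^+ 2).
  move=> y; apply: (@continuous_comp _ _ _ (fun x : E => x 0 i) (fun r : R => r ^+ 2)).
    exact: coord_continuous.
  exact: exprn_continuous.
exact: (cvgD (cvgD (sq _ x) (sq _ x)) (sq _ x)).
Qed.

Lemma mulmx_entry_bound (h : E) M (a : R) : (forall i j, `|M i j| <= a) ->
  euclid (h *m M) <= 6 * a * euclid h.
Proof.
move=> Ma; have -> : 6 * a * euclid h = 2 * (3 * a * euclid h) by ring.
apply: euclid_le => j; rewrite mxE; apply: le_trans (ler_norm_sum _ _ _) _.
have -> : 3 * a * euclid h = \sum_(i < 3) euclid h * a.
  by rewrite sumr_const card_ord -mulr_natl; ring.
apply: ler_sum => i _; rewrite normrM; apply: ler_pM => //.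
exact: abs_coord_le_euclid.
Qed.

Lemma opnorm_le M (a : R) : (forall h, euclid h <= 1 -> euclid (h *m M) <= a) ->
  opnorm M <= a.
Proof.
move=> H; apply: ge_sup; first by exists (euclid ((0 : E) *m M)), 0 => //=; rewrite euclid0.
by move=> _ [h /= h1 <-]; exact: H.
Qed.

Lemma opnorm_entries_le M (a : R) : (forall i j, `|M i j| <= a) -> opnorm M <= 6 * a.
Proof.
move=> Ma; apply: opnorm_le => h h1; apply: le_trans (mulmx_entry_bound h Ma) _.
have a0 : 0 <= a by apply: le_trans (Ma 0 0).
by rewrite -[leRHS]mulr1 ler_wpM2l// mulr_ge0.
Qed.

Lemma mulmx_opnorm (h : E) M : euclid (h *m M) <= opnorm M * euclid h.
Proof.
have [h0|h0] := eqVneq (euclid h) 0.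
  by rewrite (euclid_eq0 h0) mul0mx euclid0 mulr0.
have hgt : 0 < euclid h by rewrite lt_neqAle eq_sym h0 euclid_ge0.
rewrite -ler_pdivrMr//.
have -> : euclid (h *m M) / euclid h = euclid (((euclid h)^-1 *: h) *m M).
  by rewrite -scalemxAl euclidZ gtr0_norm ?invr_gt0// mulrC.
apply: ub_le_sup; last first.
  by exists ((euclid h)^-1 *: h) => //=; rewrite euclidZ gtr0_norm ?invr_gt0// mulVf.
(* A real [sup] dominates the members of its set only if the set is bounded above; the largest entry
   of [M] supplies a bound. *)
pose a := \big[Num.max/0]_(p : 'I_3 * 'I_3) `|M p.1 p.2|.
have Ma i j : `|M i j| <= a by apply: (le_bigmax _ (fun p : 'I_3 * 'I_3 => `|M p.1 p.2|) (i, j)).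
exists (6 * a) => _ [g /= g1 <-]; apply: le_trans (mulmx_entry_bound g Ma) _.
have a0 : 0 <= a by apply: le_trans (Ma 0 0).
by rewrite -[leRHS]mulr1 ler_wpM2l// mulr_ge0.
Qed.

Lemma opnorm_ge0 M : 0 <= opnorm M.
Proof.
have := @mulmx_opnorm (delta_mx 0 0) M.
have -> : euclid (delta_mx 0 0 : E) = 1.
  by rewrite /euclid sum3E !mxE !eqxx /= !expr0n /= expr1n !addr0 sqrtr1.
by rewrite mulr1; apply: le_trans; exact: euclid_ge0.
Qed.

Section derive_dot.
Context {V : normedModType R}.

Lemma derivable_dot e (f : V -> E) (x v : V) :
  derivable f x v -> derivable (fun z => dot e (f z)) x v.
Proof.
move=> /derivable_mxP df.
rewrite (_ : (fun z => dot e (f z)) = \sum_(i < 3) (fun z => e 0 i * f z 0 i)).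
  by apply: derivable_sum => i; apply: derivableM; [exact: derivable_cst|exact: df].
by apply/funext => y; rewrite /dot fct_sumE.
Qed.

Lemma derive_dot e (f : V -> E) (x v : V) :
  derivable f x v -> 'D_v (fun z => dot e (f z)) x = dot e ('D_v f x).
Proof.
move=> df; have /derivable_mxP dfi := df.
rewrite (_ : (fun z => dot e (f z)) = \sum_(i < 3) (fun z => e 0 i * f z 0 i)); last first.
  by apply/funext => y; rewrite /dot fct_sumE.
rewrite derive_sum => [|i]; last by apply: derivableM; [exact: derivable_cst|exact: dfi].
apply: eq_bigr => i _; rewrite (@deriveMl _ _ (fun z => f z 0 i) (e 0 i)); last exact: dfi.
by rewrite (derive_mx df) mxE.
Qed.

End derive_dot.

End euclidean.

(** * The vorticity equation *)

Section parabolic.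
Context {R : realType}.
Notation E := 'rV[R]_3.

Section class_C2.
Variables (w : E -> E) (C2 : class_C 2 w).

Lemma class_C2_derivable v x : derivable w x v.
Proof. by have [_ dC] := C2; have [] := dC v. Qed.

Lemma class_C2_derivable2 v x : derivable ('D_v w) x v.
Proof. by have [_ dC] := C2; have [_ [_ H]] := dC v; have [] := H v. Qed.

Lemma class_C2_cont_derive v : continuous ('D_v w).
Proof. by have [_ dC] := C2; have [_ []] := dC v. Qed.

Lemma class_C2_cont_derive2 v : continuous ('D_v ('D_v w)).
Proof. by have [_ dC] := C2; have [_ [_ H]] := dC v; have [_] := H v. Qed.

Lemma derive_dot_at e v x : 'D_v (fun z => dot e (w z)) x = dot e ('D_v w x).
Proof. by apply: derive_dot; exact: class_C2_derivable. Qed.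

Lemma derive_dot_fun e v : 'D_v (fun z => dot e (w z)) = (fun z => dot e ('D_v w z)).
Proof. by apply/funext => z; exact: derive_dot_at. Qed.

Lemma derive2_dot_at e v x :
  'D_v ('D_v (fun z => dot e (w z))) x = dot e ('D_v ('D_v w) x).
Proof. by rewrite derive_dot_fun; apply: derive_dot; exact: class_C2_derivable2. Qed.

Lemma derivable_dot_fun e v x : derivable (fun z => dot e (w z)) x v.
Proof. by apply: derivable_dot; exact: class_C2_derivable. Qed.

Lemma derivable2_dot_fun e v x : derivable ('D_v (fun z => dot e (w z))) x v.
Proof. by rewrite derive_dot_fun; apply: derivable_dot; exact: class_C2_derivable2. Qed.

End class_C2.

(** Pairing with a constant vector turns the system into scalar equations with the drift [b], in
    which the stretching term is a source. *)
Lemma dot_equation (b w : R -> E -> E) (w0 : E -> E) (e : E) (s : R) (x : E) :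
  vorticity_solution b w w0 -> 0 < s ->
  'D_1 (fun r => dot e (w r x)) s
    + \sum_k b s x 0 k * 'D_('e_k) (fun z => dot e (w s z)) x
    - 2^-1 * \sum_k 'D_('e_k) ('D_('e_k) (fun z => dot e (w s z))) x
  = dot e (w s x *m gradmx (b s) x).
Proof.
move=> [[_ [dt _] C2 _ _] _ _ eqn] s0; have C2s := C2 s s0.
have Dt : 'D_1 (fun r => dot e (w r x)) s = dot e ('D_1 (w ^~ x) s).
  by apply: (@derive_dot _ _ e (w ^~ x)); exact: dt.
have S1 : \sum_k b s x 0 k * 'D_('e_k) (fun z => dot e (w s z)) x =
    dot e (\sum_(j < 3) b s x 0 j *: pd j (w s) x).
  rewrite dot_sumr; apply: eq_bigr => k _; rewrite dotZr; congr (_ * _).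
  exact: derive_dot_at.
have S2 : \sum_k 'D_('e_k) ('D_('e_k) (fun z => dot e (w s z))) x = dot e (laplacian (w s) x).
  rewrite dot_sumr; apply: eq_bigr => k _.
  exact: derive2_dot_at.
have := congr1 (dot e) (eqn s x s0).
have -> : dot e 0 = 0 by rewrite -(scale0r (0 : E)) dotZr mul0r.
rewrite !dotDr !dotNr dotZr Dt S1 S2 => /eqP; rewrite -!addrA addrCA.
move: (dot e _) (dot e _) (dot e _) (_ * _) => A B C D /eqP; lra.
Qed.

Lemma sup_balance_contra (D S l X Y : R) :
  X + Y <= D -> S <= X -> D - 2^-1 * l = S -> l <= 0 -> 0 < Y -> False.
Proof. lra. Qed.

Section sup_bound.
Variables (b w : R -> E -> E) (w0 : E -> E) (t G Om : R).
Hypotheses (t0 : 0 < t) (G0 : 0 <= G) (Om0 : 0 < Om).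
Hypothesis sol : vorticity_solution b w w0.
Hypothesis w0Om : forall x, euclid (w0 x) <= Om.
Hypothesis bG : forall s x, 0 < s <= t -> opnorm (gradmx (b s) x) <= G / Num.sqrt s.

Let ex (s : R) := 2 * G * Num.sqrt s + t^-1 * s.

Let K : set (R * E) := `[0, t] `*` cube 0 1.

Let Q (z : R * E) := euclid (w z.1 z.2) * expR (- ex z.1).

Let cQ : {within K, continuous Q}.
Proof.
have cw : {within K, continuous (fun z => w z.1 z.2)}.
  have [[cw _ _ _ _] _ _ _] := sol.
  apply: continuous_subspaceW cw => z [/= + _].
  by rewrite in_itv/= => /andP[].
have cex : continuous (fun z : R * E => expR (- ex z.1)).
  move=> z; apply: (@continuous_comp _ _ _ fst (fun s : R => expR (- ex s))); first exact: cvg_fst.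
  apply: (@continuous_comp _ _ _ (fun s : R => - ex s) expR); last exact: continuous_expR.
  apply: cvgN; apply: cvgD; apply: cvgM.
  - exact: cvg_cst.
  - exact: sqrt_continuous.
  - exact: cvg_cst.
  - exact: cvg_id.
move=> z; apply: cvgM; last exact: continuous_subspaceT cex z.
apply: (@cvg_comp _ _ _ (fun z : R * E => w z.1 z.2) (@euclid R) _ (nbhs (w z.1 z.2))); first exact: cw.
exact: continuous_euclid.
Qed.

Section at_max.
Variables (s0 : R) (x0 : E).
Hypothesis s0K : 0 <= s0 <= t.
Hypothesis Pos : Om < Q (s0, x0).
Hypothesis Max : forall s x, 0 <= s <= t -> Q (s, x) <= Q (s0, x0).

Let s00 : 0 < s0.
Proof.
have /andP[s1 _] := s0K; rewrite lt_neqAle s1 andbT; apply/eqP => E0.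
have := Pos; rewrite /Q /= -E0 /ex sqrtr0 !mulr0 addr0 oppr0 expR0 mulr1.
by have [_ _ -> _] := sol; rewrite ltNge w0Om.
Qed.

(** The Euclidean norm is never differentiated. The component of [w] along its value [e] at the
    maximum satisfies a scalar equation; by Cauchy-Schwarz it lies below [N] times the bound on
    [|w|], with equality at [(s0, x0)]. *)
Let e := w s0 x0.
Let N := euclid e.
Let q := Q (s0, x0).

Let N0 : 0 < N.
Proof.
have q0 : 0 < Q (s0, x0) by exact: lt_trans Pos.
by move: q0; rewrite /Q pmulr_lgt0// expR_gt0.
Qed.

Let NE : N = q * expR (ex s0).
Proof. by rewrite /q /Q /= -mulrA -expRD addNr expR0 mulr1. Qed.

Let w_le s x : 0 <= s <= t -> euclid (w s x) <= q * expR (ex s).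
Proof. by move=> sK; rewrite -ler_pdivrMr ?expR_gt0// -expRN; exact: Max. Qed.

Let dot_le s x : 0 <= s <= t -> dot e (w s x) <= N * (q * expR (ex s)).
Proof.
move=> sK; apply: le_trans (cauchy_schwarz _ _) _.
by apply: ler_wpM2l; [exact: ltW|exact: w_le].
Qed.

Let dotE : dot e (w s0 x0) = N * (q * expR (ex s0)).
Proof. by rewrite -NE dotxx expr2. Qed.

Lemma sup_no_max : False.
Proof.
have s0t : 0 < s0 <= t by rewrite s00; have /andP[] := s0K.
have [[_ [dt _] C2 _ _] _ _ _] := sol; have C2s := C2 s0 s00.
have sp k : 'D_('e_k) (fun z => dot e (w s0 z)) x0 = 0 /\
    'D_('e_k) ('D_('e_k) (fun z => dot e (w s0 z))) x0 <= 2 * 0.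
  apply: (@derive_le_quadratic _ _ _ _ _ _ _ 1) => // [y||h _].
  - exact: derivable_dot_fun.
  - exact: derivable2_dot_fun.
  by rewrite !mul0r !addr0 dotE; exact: dot_le.
have S1 : \sum_k b s0 x0 0 k * 'D_('e_k) (fun z => dot e (w s0 z)) x0 = 0.
  by apply: big1 => k _; have [-> _] := sp k; rewrite mulr0.
have S2 : \sum_k 'D_('e_k) ('D_('e_k) (fun z => dot e (w s0 z))) x0 <= 0.
  by apply: sumr_le0 => k _; have [_] := sp k; rewrite mulr0.
have dex : is_derive s0 1 ex (G / Num.sqrt s0 + t^-1).
  have D1 := is_derive1_sqrt s00.
  have sn0 : Num.sqrt s0 != 0 by rewrite gt_eqF// sqrtr_gt0.
  have tn0 : t != 0 by rewrite gt_eqF.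
  rewrite /ex; apply: is_derive_eq; rewrite /GRing.scale /= !mulr1.
  by field; rewrite ?sn0 ?tn0.
pose g s := N * (q * expR (ex s)).
have dg : is_derive s0 1 g (N * N * (G / Num.sqrt s0 + t^-1)).
  have D1 := is_derive1_comp (is_derive_expR (ex s0)) dex.
  rewrite /g; apply: is_derive_eq; rewrite /GRing.scale /= {2}NE; ring.
have tD : N * N * (G / Num.sqrt s0 + t^-1) <= 'D_1 (fun r : R => dot e (w r x0)) s0.
  rewrite -(@derive_val _ _ _ _ _ _ _ dg); apply: (derive_le_touching s00) => //.
  - by apply: (@derivable_dot _ _ e (w ^~ x0)); exact: dt.
  move=> s /andP[]; rewrite subrr => s1 s2; apply: dot_le.
  by rewrite (ltW s1) (le_trans (ltW s2))//; have /andP[] := s0K.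
have stretch : dot e (w s0 x0 *m gradmx (b s0) x0) <= N * N * (G / Num.sqrt s0).
  apply: le_trans (cauchy_schwarz _ _) _; rewrite -mulrA; apply: ler_wpM2l; first exact: ltW.
  apply: le_trans (mulmx_opnorm _ _) _; rewrite mulrC; apply: ler_wpM2l; first exact: ltW.
  exact: bG.
have := dot_equation e x0 sol s00; rewrite S1 addr0 => eqn.
have : 0 < N * N * t^-1 by rewrite !mulr_gt0// invr_gt0.
rewrite mulrDr in tD.
exact: sup_balance_contra tD stretch eqn S2.
Qed.

End at_max.

Lemma vorticity_sup_bound s x : 0 <= s <= t ->
  euclid (w s x) <= Om * expR (2 * G * Num.sqrt t + 1).
Proof.
move=> sK; have tK : 0 <= t by exact: ltW.
suff QO : Q (s, x) <= Om.
  have -> : euclid (w s x) = Q (s, x) * expR (ex s).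
    by rewrite /Q /= -mulrA -expRD addNr expR0 mulr1.
  apply: ler_pM => //; first by rewrite mulr_ge0 ?euclid_ge0// expR_ge0.
  have /andP[s1 s2] := sK.
  rewrite ler_expR; apply: lerD; last by rewrite mulrC ler_pdivrMr// mul1r.
  by apply: ler_wpM2l; [exact: mulr_ge0|rewrite ler_wsqrtr].
rewrite leNgt; apply/negP => pos.
have K0 : K !=set0 by exists (0, 0); split => /= [|i]; rewrite in_itv/= ?mxE ?lexx ?ler01.
have cK : compact K by apply: compact_setX; [exact: segment_compact|exact: compact_cube].
have [[s0 x0] /set_mem[/= s0K x0K] mx] := compact_EVT_max K0 cK cQ.
rewrite in_itv/= in s0K.
have Max s' x' : 0 <= s' <= t -> Q (s', x') <= Q (s0, x0).
  move=> sK'; have [m mP] := unit_cube_reduction x'.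
  have wP : shift_periodic (w s').
    by have [_ wP _ _] := sol; apply: wP; have /andP[] := sK'.
  have -> : Q (s', x') = Q (s', x' + lattice_vec m) by rewrite /Q /= shift_periodic_lattice.
  apply: mx; rewrite inE; split; first by rewrite /= in_itv.
  by move=> i /=; rewrite in_itv/=.
by apply: (sup_no_max s0K (lt_le_trans pos (Max _ _ sK)) Max).
Qed.

End sup_bound.

End parabolic.

(** * Mean-zero functions *)

Section mean_zero.
Context {R : realType}.
Notation E := 'rV[R]_3.
Notation mu := (@lebesgue_measure R).

(* No measurability is needed, the integral of a nonnegative function being a
   supremum over the simple functions below it. *)
Lemma le_integral_nonmeasurable {d} {T : measurableType d} (nu : {measure set T -> \bar R})
    (D : set T) (f g : T -> \bar R) :
  (forall x, D x -> (0 <= f x)%E) -> (forall x, D x -> (f x <= g x)%E) ->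
  (\int[nu]_(x in D) f x <= \int[nu]_(x in D) g x)%E.
Proof.
move=> f0 fg; rewrite !ge0_integralE//; last by move=> x Dx; apply: le_trans (fg _ Dx); exact: f0.
apply: ge_ereal_sup => _ [h /= hf <-]; apply: ereal_sup_ubound; exists h => //= x.
by apply: le_trans (hf x) _; apply: lee_restrict.
Qed.

(** Nonnegativity of [m] allows the comparison with constants without measurability. Both bounds
    being finite, so is the extended integral, and [fine] does not alter it. *)
Lemma Rintegral01_bounds (f : R -> R) (m M : R) : 0 <= m ->
  (forall x, 0 <= x <= 1 -> m <= f x <= M) ->
  m <= \int[mu]_(x in `[0, 1]) f x <= M.
Proof.
move=> m0 mfM.
have cstE (c : R) : (\int[mu]_(x in `[0%R, 1%R]) c%:E)%E = c%:E.
  by rewrite integral_cst//= lebesgue_measure_itv/= lte_fin ltr01 sube0 mule1.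
have lo : (m%:E <= \int[mu]_(x in `[0%R, 1%R]) (f x)%:E)%E.
  rewrite -[X in (X <= _)%E]cstE; apply: le_integral_nonmeasurable => x; first by rewrite lee_fin.
  by rewrite /= in_itv/= => /mfM /andP[+ _]; rewrite lee_fin.
have hi : (\int[mu]_(x in `[0%R, 1%R]) (f x)%:E <= M%:E)%E.
  rewrite -[X in (_ <= X)%E]cstE; apply: le_integral_nonmeasurable => x.
    by rewrite /= in_itv/= => /mfM /andP[+ _]; rewrite lee_fin; exact: le_trans.
  by rewrite /= in_itv/= => /mfM /andP[_]; rewrite lee_fin.
rewrite /Rintegral.
move: lo hi; case: (\int[mu]_(x in _) _)%E => [r| |]//=.
by rewrite !lee_fin => -> ->.
Qed.

Lemma RintegralN01 (f : R -> R) : (forall x, 0 <= x <= 1 -> 0 <= f x) ->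
  \int[mu]_(x in `[0, 1]) (- f x) = - \int[mu]_(x in `[0, 1]) f x.
Proof.
move=> f0; rewrite /Rintegral.
under eq_integral do rewrite EFinN.
by rewrite integral_ge0N ?fineN.
Qed.

Let point3 (x1 x2 x3 : R) : E := \row_j [:: x1; x2; x3]`_j.

Let point3_cube x1 x2 x3 : 0 <= x1 <= 1 -> 0 <= x2 <= 1 -> 0 <= x3 <= 1 ->
  cube 0 1 (point3 x1 x2 x3).
Proof.
by move=> h1 h2 h3 j; rewrite in_itv mxE; case: j => -[|[|[|//]]].
Qed.

Let triple (f : E -> R) := \int[mu]_(x1 in `[0, 1]) \int[mu]_(x2 in `[0, 1])
  \int[mu]_(x3 in `[0, 1]) f (point3 x1 x2 x3).

Lemma triple_integral_gt0 (f : E -> R) : continuous f ->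
  (forall x, 0 < f x) -> 0 < triple f.
Proof.
move=> cf f0.
have K0 : cube (0 : R) 1 !=set0 by exists 0 => i; rewrite in_itv/= mxE lexx ler01.
have cf' : {within cube 0 1, continuous f} by exact: continuous_subspaceT.
have [a _ amin] := compact_EVT_min K0 (compact_cube (a:=0) (b:=1)) cf'.
have [c _ cmax] := compact_EVT_max K0 (compact_cube (a:=0) (b:=1)) cf'.
apply: (lt_le_trans (f0 a)).
suff /andP[] : f a <= triple f <= f c by [].
have fa0 := ltW (f0 a).
do 3!(apply: Rintegral01_bounds => // ? ?).
by rewrite amin ?cmax// inE; exact: point3_cube.
Qed.

(** The fixed sign of [f] lets the minus sign through each of the three integrals without any
    integrability argument. *)
Lemma triple_integralN (f : E -> R) : continuous f -> (forall x, 0 < f x) ->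
  triple (fun x => - f x) = - triple f.
Proof.
move=> cf f0; have f0' x : 0 <= f x by exact: ltW.
rewrite /triple -RintegralN01; last by move=> x1 _; do 2!(apply: Rintegral_ge0 => ? _).
apply: eq_Rintegral => x1 _; rewrite -RintegralN01; last first.
  by move=> x2 _; apply: Rintegral_ge0 => ? _.
by apply: eq_Rintegral => x2 _; rewrite -RintegralN01.
Qed.

(** A component of strict constant sign would have a nonzero integral. The two points turn a bound
    on the oscillation into a bound on the component itself. *)
Lemma mean_zero_signs (v : E -> E) i : continuous (fun x => dot 'e_i (v x)) ->
  cube_integral v = 0 ->
  (exists y, dot 'e_i (v y) <= 0) /\ (exists y, 0 <= dot 'e_i (v y)).
Proof.
move=> cv v0; have tr0 : triple (fun x => dot 'e_i (v x)) = 0.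
  have /rowP/(_ i) := v0; rewrite !mxE => <-.
  do 3!(apply: eq_Rintegral => ? _).
  by rewrite dot_delta.
split; apply: contrapT => /forallNP H.
  have pos x : 0 < dot 'e_i (v x) by rewrite ltNge; apply/negP; exact: H.
  by have := triple_integral_gt0 cv pos; rewrite tr0 ltxx.
have pos x : 0 < - dot 'e_i (v x) by rewrite oppr_gt0 ltNge; apply/negP; exact: H.
have cN : continuous (fun x => - dot 'e_i (v x)) by move=> x; exact: (cvgN (cv x)).
have := triple_integral_gt0 cN pos; have := triple_integralN cN pos.
have -> : (fun x => - - dot 'e_i (v x)) = (fun x => dot 'e_i (v x)).
  by apply/funext => x; rewrite opprK.
by rewrite tr0 => /eqP; rewrite eq_sym oppr_eq0 => /eqP ->; rewrite ltxx.
Qed.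

End mean_zero.

(** * The Poisson equation for the velocity *)

Section poisson_coord.
Context {R : realType}.
Notation E := 'rV[R]_3.

(** The cross product of [n] and ['e_a]: the scalar product of [n] with [curl u] is the sum over [a]
    of those of this vector with the derivative of [u] in direction [a], which puts it in divergence
    form. *)
Definition curl_coef (n : E) (a : 'I_3) : E :=
  n 0 (a + 2%:R) *: 'e_(a + 1) - n 0 (a + 1) *: 'e_(a + 2%:R).

Lemma dot_curl_coef n a (z : E) :
  dot (curl_coef n a) z = n 0 (a + 2%:R) * z 0 (a + 1) - n 0 (a + 1) * z 0 (a + 2%:R).
Proof.
rewrite -!(dot_delta _ z) /dot !mulr_sumr -sumrB; apply: eq_bigr => i _.
by rewrite /curl_coef !mxE; ring.
Qed.

Lemma dot_curl (n : E) (u : E -> E) x :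
  dot n (curl u x) = \sum_a dot (curl_coef n a) (pd a u x).
Proof.
under eq_bigr do rewrite dot_curl_coef.
rewrite [dot n _]/dot !sum3E !mxE.
have e1 : ord0 + 1 = lift ord0 ord0 :> 'I_3 by exact: val_inj.
have e2 : ord0 + 2%:R = lift ord0 (lift ord0 ord0) :> 'I_3 by exact: val_inj.
have e3 : lift ord0 ord0 + 1 = lift ord0 (lift ord0 ord0) :> 'I_3 by exact: val_inj.
have e4 : lift ord0 ord0 + 2%:R = ord0 :> 'I_3 by exact: val_inj.
have e5 : lift ord0 (lift ord0 ord0) + 1 = ord0 :> 'I_3 by exact: val_inj.
have e6 : lift ord0 (lift ord0 ord0) + 2%:R = lift ord0 ord0 :> 'I_3 by exact: val_inj.
rewrite !(e1, e2, e3, e4, e5, e6).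
by move: (pd ord0 u x) (pd (lift ord0 ord0) u x) (pd _ u x) => A B C; ring.
Qed.

Lemma dot_curl_coef_le (n : E) a (z : E) (F : R) : (forall i, `|n 0 i| <= 1) ->
  (forall i, `|z 0 i| <= F) -> `|dot (curl_coef n a) z| <= 2 * F.
Proof.
move=> n1 zF; rewrite dot_curl_coef; apply: le_trans (ler_normB _ _) _.
have H i j : `|n 0 i * z 0 j| <= F by rewrite normrM -[leRHS]mul1r; apply: ler_pM.
by have := H (a + 2%:R) (a + 1); have := H (a + 1) (a + 2%:R); lra.
Qed.

Lemma delta_le1 (i j : 'I_3) : `|('e_i : E) 0 j| <= 1.
Proof. by rewrite !mxE eqxx/=; case: eqP; rewrite ?normr1// normr0. Qed.

Lemma continuous_dot {T : topologicalType} (n : E) (f : T -> E) :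
  continuous f -> continuous (fun x => dot n (f x)).
Proof.
move=> cf; have c (i : 'I_3) : continuous (fun x => n 0 i * f x 0 i).
  move=> x; apply: cvgM; first exact: cvg_cst.
  by apply: (@continuous_comp _ _ _ f (fun z : E => z 0 i)); [exact: cf|exact: coord_continuous].
have -> : (fun x => dot n (f x)) = (fun x => n 0 ord0 * f x 0 ord0 +
    n 0 (lift ord0 ord0) * f x 0 (lift ord0 ord0)
    + n 0 (lift ord0 (lift ord0 ord0)) * f x 0 (lift ord0 (lift ord0 ord0))).
  by apply/funext => x; rewrite /dot sum3E.
by move=> x; exact: (cvgD (cvgD (c _ x) (c _ x)) (c _ x)).
Qed.

Section solution.
(** Subtracting the constant [cst0] from [w] changes no derivative. The value 0 gives the estimate
    by the size of [w], the value [w 0] the estimate by its oscillation. *)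
Variables (w v : E -> E) (F : R) (cst0 : E).
Hypotheses (dw : forall d x, derivable w x 'e_d)
  (cdw : forall d n, continuous (fun x => dot n ('D_('e_d) w x)))
  (wP : shift_periodic w) (sol : poisson_solution w v)
  (wF : forall y i, `|(w y - cst0) 0 i| <= F).

Lemma laplacian_dot (i : 'I_3) (y : E) :
  \sum_d 'D_('e_d) ('D_('e_d) (fun z => dot 'e_i (v z))) y
  = - \sum_a dot (curl_coef 'e_i a) (pd a w y).
Proof.
have [C2 _ _ lap] := sol.
rewrite -dot_curl -dotNr -lap /laplacian dot_sumr; apply: eq_bigr => k _.
exact: derive2_dot_at.
Qed.

Lemma poisson_coord_osc (i : 'I_3) x y : dot 'e_i (v x) - dot 'e_i (v y) <= 3 * F.
Proof.
have [C2 vP _ lap] := sol.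
have -> : 3 * F = 3 / 2 * (2 * F) by field.
pose f a z := - dot (curl_coef 'e_i a) (w z - cst0).
have dB a z : derivable (fun z => w z - cst0) z 'e_a.
  by apply: derivableB; [exact: dw|exact: derivable_cst].
have DB a z : 'D_('e_a) (fun z => w z - cst0) z = 'D_('e_a) w z.
  by rewrite deriveB ?derive_cst ?subr0//; exact: dw.
have Df a z : 'D_('e_a) (f a) z = - dot (curl_coef 'e_i a) (pd a w z).
  rewrite /f deriveN; last by apply: derivable_dot; exact: dB.
  by rewrite derive_dot ?DB//; exact: dB.
apply: (@poisson_osc _ (fun z => dot 'e_i (v z)) f (2 * F)).
- by move=> j z; rewrite vP.
- by apply: continuous_dot; have [] := C2.
- by move=> d z; exact: derivable_dot_fun.
- by move=> d z; exact: derivable2_dot_fun.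
- move=> d; rewrite (_ : 'D_('e_d) _ = (fun z => dot 'e_i ('D_('e_d) ('D_('e_d) v) z))).
    by apply: continuous_dot; exact: class_C2_cont_derive2.
  by apply/funext => z; exact: derive2_dot_at.
- by move=> d j z; rewrite /f wP.
- by move=> d z; apply: derivableN; apply: derivable_dot; exact: dB.
- move=> d; rewrite (_ : 'D_('e_d) _ = (fun z => - dot (curl_coef 'e_i d) (pd d w z))).
    by move=> z; exact: (cvgN (@cdw d (curl_coef 'e_i d) z)).
  by apply/funext => z; exact: Df.
- by move=> d z; rewrite normrN; apply: dot_curl_coef_le; [exact: delta_le1|exact: wF].
- by move=> z; rewrite laplacian_dot -sumrN; apply: eq_bigr => d _; rewrite Df.
Qed.

Lemma poisson_coord_bound (i : 'I_3) x : `|dot 'e_i (v x)| <= 3 * F.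
Proof.
have [C2 vP v0 _] := sol.
have cv : continuous (fun x => dot 'e_i (v x)) by apply: continuous_dot; have [] := C2.
have [[y1 H1] [y2 H2]] := mean_zero_signs cv v0.
have := poisson_coord_osc i x y1; have := poisson_coord_osc i y2 x.
by rewrite ler_norml => A B; apply/andP; split; lra.
Qed.

End solution.

End poisson_coord.

(** * Gradient estimates *)

Section gradient.
Context {R : realType}.
Notation E := 'rV[R]_3.

(** Solves the implicit condition on [a] for a time interval of length [s ^ 2]. The drift part
    [12 B M a] is half of what the first term of [a] contributes to [a ^ 2]; the square of the other
    two terms covers the rest, because [(M / s) * (F * s) = M * F]. *)
Lemma doubling_constant (B M F s : R) : 0 <= B -> 0 < M -> 0 <= F -> 0 < s ->
  let a := 24 * B * M + 4 * M / s + 4 * F * s in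
  0 < a /\ 4 * M * (3 * B * a + F + M / s ^+ 2) <= a ^+ 2.
Proof.
move=> B0 M0 F0 s0 a; set p := M / s; set q := F * s.
have p0 : 0 < p by exact: divr_gt0.
have q0 : 0 <= q by rewrite mulr_ge0// ltW.
have r0 : 0 <= B * M by rewrite mulr_ge0// ltW.
have aE : a = 24 * (B * M) + 4 * p + 4 * q by rewrite /a /p /q; ring.
have MF : M * F = p * q by rewrite /p /q; field; rewrite gt_eqF.
have MM : M * (M / s ^+ 2) = p ^+ 2 by rewrite /p; field; rewrite gt_eqF.
have a0 : 0 < a by rewrite aE; lra.
split=> //.
have -> : 4 * M * (3 * B * a + F + M / s ^+ 2) =
    12 * (B * M) * a + 4 * (M * F) + 4 * (M * (M / s ^+ 2)) by ring.
rewrite MF MM; move: (B * M) r0 aE a0 => r r0 aE a0; rewrite aE.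
have := mulr_ge0 r0 q0; have := mulr_ge0 r0 (ltW p0); have := mulr_ge0 (ltW p0) q0.
have := sqr_ge0 q; have := sqr_ge0 r; have := sqr_ge0 p.
rewrite !expr2; lra.
Qed.

Lemma lipschitz_increment (u : E -> R) (a : R) (k : 'I_3) x (h : R) :
  (forall y z, u y - u z <= a * \sum_j `|y 0 j - z 0 j|) ->
  u (h *: 'e_k + x) <= u x + a * `|h|.
Proof.
move=> ua; have := ua (h *: 'e_k + x) x.
have -> : \sum_j `|(h *: 'e_k + x) 0 j - x 0 j| = `|h|.
  rewrite (bigD1 k)//= big1 ?addr0; first by rewrite !mxE !eqxx mulr1 addrK.
  by move=> j jk; rewrite !mxE eqxx (negbTE jk) mulr0 add0r subrr normr0.
by rewrite lerBlDl.
Qed.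

Lemma derive_le_lipschitz (u : E -> R) (a : R) (k : 'I_3) x :
  derivable u x 'e_k ->
  (forall y z, u y - u z <= a * \sum_j `|y 0 j - z 0 j|) -> `|'D_('e_k) u x| <= a.
Proof.
move=> du ua; apply: (@derive_abs_le _ _ _ _ _ _ 1) => // h _.
exact: lipschitz_increment.
Qed.

Section vorticity.
Variables (b w : R -> E -> E) (w0 : E -> E) (t G Bn W : R).
Hypotheses (t0 : 0 < t) (G0 : 0 <= G) (B0 : 0 <= Bn) (W0 : 0 < W).
Hypothesis sol : vorticity_solution b w w0.
Hypothesis bG : forall s x, 0 < s <= t -> opnorm (gradmx (b s) x) <= G / Num.sqrt s.
Hypothesis bB : forall s x k, 0 < s <= t -> `|b s x 0 k| <= Bn.
Hypothesis wW : forall s x, 0 <= s <= t -> euclid (w s x) <= W.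

Lemma dot_delta_le (i : 'I_3) (z : E) : `|dot 'e_i z| <= euclid z.
Proof. by rewrite dot_delta; exact: abs_coord_le_euclid. Qed.

Lemma vorticity_lipschitz i x y : dot 'e_i (w t x) - dot 'e_i (w t y) <=
  W / Num.sqrt t * (16 + 48 * (Bn * Num.sqrt t) + 4 * (G * Num.sqrt t)) *
    \sum_k `|x 0 k - y 0 k|.
Proof.
have [[cw [dt _] C2 _ _] wP _ _] := sol.
have t0' := t0; have W0' := W0.
(* On [[t / 2, t]] the bound [G / sqrt s] stays below [G / r], and the length of the interval is
   [r ^ 2], the form required by [doubling_constant]. *)
set r := Num.sqrt (t / 2).
have r0 : 0 < r by rewrite sqrtr_gt0; lra.
have st0 : 0 < Num.sqrt t by rewrite sqrtr_gt0.
have tau : t - t / 2 = r ^+ 2 by rewrite sqr_sqrtr; lra.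
have str : Num.sqrt t <= 2 * r.
  have r20 : 0 <= 2 * r by rewrite mulr_ge0// ltW.
  rewrite -(@ler_pXn2r _ 2)// ?nnegrE ?(ltW st0)// exprMn sqr_sqrtr ?(ltW t0)// -tau.
  lra.
have F0 : 0 <= G / r * W by rewrite mulr_ge0 ?(ltW W0)// divr_ge0// ltW.
have M0 : 0 < 2 * W by lra.
have [a0 ac] := doubling_constant B0 M0 F0 r0.
set a := 24 * Bn * (2 * W) + 4 * (2 * W) / r + 4 * (G / r * W) * r in a0 ac.
have T01 : t / 2 < t by lra.
have pos s : t / 2 < s <= t -> 0 < s <= t.
  by move=> /andP[s1 ->]; rewrite andbT; lra.
have pos' s : t / 2 <= s <= t -> 0 <= s <= t.
  by move=> /andP[s1 ->]; rewrite andbT; lra.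
have C2s s : t / 2 < s <= t -> class_C 2 (w s) by move=> /pos /andP[s1 _]; exact: C2.
have key := @lipschitz_doubling R (fun s z => dot 'e_i (w s z)) (fun s z k => b s z 0 k)
  (t / 2) t Bn (G / r * W) (2 * W) a T01 B0 F0 M0 a0.
apply: (@le_trans _ _ (a * \sum_k `|x 0 k - y 0 k|)).
  apply: key.
  - have cw' : {within [set z : R * E | t / 2 <= z.1 <= t], continuous (fun z => w z.1 z.2)}.
      by apply: continuous_subspaceW cw => z /= /pos' /andP[].
    move=> z; apply: (@cvg_comp _ _ _ (fun z : R * E => w z.1 z.2) (dot 'e_i) _ (nbhs (w z.1 z.2))); first exact: cw'.
    by apply: (@continuous_dot _ _ 'e_i id) => ?.
  - by move=> s /pos' /andP[s0 _] j z; rewrite wP.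
  - move=> s z /pos /andP[s0 _]; apply: (@derivable_dot _ _ 'e_i (w ^~ z)); exact: dt.
  - by move=> s sK k z; apply: derivable_dot_fun; exact: C2s.
  - by move=> s sK k z; apply: derivable2_dot_fun; exact: C2s.
  - move=> s z sK; have /andP[s0 st] := pos s sK.
    rewrite (dot_equation 'e_i z sol s0).
    apply: le_trans (dot_delta_le _ _) _; apply: le_trans (mulmx_opnorm _ _) _.
    apply: ler_pM; [exact: opnorm_ge0|exact: euclid_ge0| |].
      apply: le_trans (bG _ (pos s sK)) _; apply: ler_wpM2l => //.
      rewrite lef_pV2 ?posrE ?sqrtr_gt0// ?divr_gt0//.
      by have /andP[/ltW s2 _] := sK; rewrite /r ler_wsqrtr.
    by apply: wW; rewrite (ltW s0).
  - by move=> s z k /pos; exact: bB.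
  - move=> s z z' /pos' sK; have := le_trans (dot_delta_le i _) (wW z sK).
    have := le_trans (dot_delta_le i _) (wW z' sK).
    by rewrite !ler_norml => /andP[A1 A2] /andP[A3 A4]; lra.
  by rewrite tau.
apply: ler_wpM2r; first by apply: sumr_ge0.
have -> : W / Num.sqrt t * (16 + 48 * (Bn * Num.sqrt t) + 4 * (G * Num.sqrt t))
  = 16 * W / Num.sqrt t + 48 * Bn * W + 4 * G * W by field; rewrite gt_eqF.
have -> : a = 8 * W / r + 48 * Bn * W + 4 * G * W by rewrite /a; field; rewrite gt_eqF.
rewrite !lerD2r ler_pdivrMr// mulrAC ler_pdivlMr//.
have -> : 16 * W * r = 8 * W * (2 * r) by ring.
by rewrite ler_pM2l// mulr_gt0.
Qed.

End vorticity.

Section poisson_gradient.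
Variables (w v : E -> E) (a : R).
Hypotheses (a0 : 0 < a) (C2w : class_C 2 w) (wP : periodic w)
  (sol : poisson_solution w v)
  (wlip : forall i x y, dot 'e_i (w x) - dot 'e_i (w y) <= a * \sum_k `|x 0 k - y 0 k|).

(** By periodicity [y] may be taken in the unit cube, where the coordinates of [y - 0] have absolute
    values of sum at most 3. *)
Let wosc y i : `|(w y - w 0) 0 i| <= 3 * a.
Proof.
have [m mP] := unit_cube_reduction y.
rewrite -(shift_periodic_lattice m y wP) !mxE -!(dot_delta i).
have S3 (f : 'I_3 -> R) : (forall k, f k <= 1) -> a * \sum_k f k <= 3 * a.
  move=> f1; have -> : 3 * a = a * \sum_(k < 3) 1 by rewrite sumr_const card_ord mulrC.
  by apply: ler_wpM2l; [exact: ltW|exact: ler_sum].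
rewrite ler_norml lerNl opprB; apply/andP; split; apply: le_trans (wlip _ _ _) _;
  apply: S3 => k; rewrite [(0 : E) 0 k]mxE ?subr0 ?sub0r ?normrN.
  by rewrite ger0_norm; have /andP[] := mP k.
by rewrite ger0_norm; have /andP[] := mP k.
Qed.

(** The components of [v] are regarded as constant in time on [[0, 1]], without drift. They are at
    most [3 * (3 * a)], so their differences are at most [M = 18 a], and half their Laplacian is at
    most [F = a]; the doubling constant is then [4 * 18 a + 4 a = 76 a]. The factor 6 passes from
    entries to the operator norm. *)
Lemma poisson_gradient_bound x : opnorm (gradmx v x) <= 456 * a.
Proof.
have [C2 vP _ _] := sol; have a0' := a0.
have dw d z : derivable w z 'e_d by exact: class_C2_derivable.
have cdw d n : continuous (fun z => dot n ('D_('e_d) w z)).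
  by apply: continuous_dot; exact: class_C2_cont_derive.
have -> : 456 * a = 6 * (76 * a) by ring.
apply: opnorm_entries_le => k i; rewrite mxE -(dot_delta i) /pd.
rewrite -(derive_dot_at C2); apply: derive_le_lipschitz; first exact: derivable_dot_fun.
have M0 : 0 < 18 * a by rewrite mulr_gt0.
have [A0 ac] := doubling_constant (lexx 0) M0 (ltW a0) ltr01.
move: A0 ac; set A := (X in 0 < X -> _).
have AE : A = 76 * a by rewrite /A; field.
rewrite AE => A0 ac y z.
have B3 := poisson_coord_bound dw cdw wP sol wosc.
apply: (@lipschitz_doubling R (fun _ => fun z => dot 'e_i (v z)) (fun _ _ _ => 0) 0 1 0 a (18 * a) (76 * a)
  ltr01 (lexx 0) (ltW a0) M0 A0).
- have cv : continuous (fun z => dot 'e_i (v z)) by apply: continuous_dot; have [] := C2.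
  apply: continuous_subspaceT => p.
  by apply: (@continuous_comp _ _ _ snd (fun z => dot 'e_i (v z))); [exact: cvg_snd|exact: cv].
- by move=> s _ j p; rewrite vP.
- by move=> s p _; exact: derivable_cst.
- by move=> s _ k' p; exact: derivable_dot_fun.
- by move=> s _ k' p; exact: derivable2_dot_fun.
- move=> s p _.
  rewrite (_ : 'D_1 _ s = 0); last exact: derive_cst.
  rewrite big1 ?addr0 ?sub0r ?normrN; last by move=> k' _; rewrite mul0r.
  rewrite (laplacian_dot sol) -dot_curl dot_delta mulrN normrN normrM.
  have pdle d j : `|(pd d w p) 0 j| <= a.
    rewrite -(dot_delta j) /pd -(derive_dot_at C2w).
    by apply: derive_le_lipschitz; [exact: derivable_dot_fun|exact: wlip].
  rewrite mxE gtr0_norm ?invr_gt0// ler_pdivrMl//.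
  apply: le_trans (ler_normB _ _) _.
  by have := pdle (i + 1) (i + 2%:R); have := pdle (i + 2%:R) (i + 1); lra.
- by move=> s p k' _; rewrite normr0.
- move=> s p p' _; have := B3 i p; have := B3 i p'.
  by rewrite !ler_norml => /andP[A1 A2] /andP[A3 A4]; lra.
- by rewrite subr0 -AE; move: ac; rewrite expr1n.
Qed.

End poisson_gradient.

End gradient.

(** * The theorem *)

Section initial_data.
Context {R : realType}.
Notation E := 'rV[R]_3.

Lemma class_C2_derivable_mixed (w : E -> E) a d x : class_C 2 w ->
  derivable ('D_a w) x d.
Proof. by move=> [_ dC]; have [_ [_ H]] := dC a; have [] := H d. Qed.

Lemma class_C2_cont_mixed (w : E -> E) a d : class_C 2 w -> continuous ('D_d ('D_a w)).
Proof. by move=> [_ dC]; have [_ [_ H]] := dC a; have [_] := H d. Qed.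

(** [parabolic_C12] gives space derivatives of [w] at positive times only; at time 0 the Poisson
    estimate uses those of [curl u0]. *)
Lemma derivable_curl (u : E -> E) (d x : E) : class_C 2 u -> derivable (curl u) x d.
Proof.
move=> C2; apply/derivable_mxP => i j.
have dpd a k : derivable (fun z => pd a u z 0 k) x d.
  have : derivable (pd a u) x d by exact: class_C2_derivable_mixed.
  by move=> /derivable_mxP; apply.
rewrite (_ : (fun z => curl u z i j) =
    (fun z => pd (j + 1) u z 0 (j + 2%:R) - pd (j + 2%:R) u z 0 (j + 1))).
  by apply: derivableB; exact: dpd.
by apply/funext => z; rewrite mxE.
Qed.

Lemma continuous_dot_derive_curl (u : E -> E) (d n : E) : class_C 2 u ->
  continuous (fun x => dot n ('D_d (curl u) x)).
Proof.
move=> C2.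
have D a x : derivable (pd a u) x d by exact: class_C2_derivable_mixed.
have -> : (fun x => dot n ('D_d (curl u) x)) =
    (fun x => \sum_a dot (curl_coef n a) ('D_d (pd a u) x)).
  apply/funext => x; rewrite -(derive_dot n (@derivable_curl u d x C2)).
  rewrite (_ : (fun z => dot n (curl u z)) = \sum_a (fun z => dot (curl_coef n a) (pd a u z))).
    rewrite derive_sum => [|a]; last by apply: derivable_dot; exact: D.
    by apply: eq_bigr => a _; apply: derive_dot; exact: D.
  by apply/funext => z; rewrite dot_curl fct_sumE.
have c a : continuous (fun x => dot (curl_coef n a) ('D_d (pd a u) x)).
  by apply: continuous_dot; exact: class_C2_cont_mixed.
move=> x; rewrite (_ : (fun x => \sum_a dot (curl_coef n a) ('D_d (pd a u) x)) = (fun x =>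
  dot (curl_coef n ord0) ('D_d (pd ord0 u) x)
  + dot (curl_coef n (lift ord0 ord0)) ('D_d (pd (lift ord0 ord0) u) x)
  + dot (curl_coef n (lift ord0 (lift ord0 ord0))) ('D_d (pd (lift ord0 (lift ord0 ord0)) u) x))).
  exact: (cvgD (cvgD (c _ x) (c _ x)) (c _ x)).
by apply/funext => z; rewrite sum3E.
Qed.

Lemma pd_section (B : R * E -> E) s (k : 'I_3) x :
  pd k (fun z => B (s, z)) x = 'D_((0, 'e_k) : R * E) B (s, x).
Proof.
rewrite /pd /derive.
have -> // : (fun h : R => h^-1 *: (((fun z => B (s, z)) \o shift x) (h *: 'e_k) - B (s, x)))
  = (fun h => h^-1 *: ((B \o shift (s, x)) (h *: ((0, 'e_k) : R * E)) - B (s, x))).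
apply/funext => h /=.
have -> : h *: ((0, 'e_k) : R * E) + (s, x) = (h * 0 + s, h *: 'e_k + x) by [].
by rewrite mulr0 add0r.
Qed.

(** The derivatives of the smooth extension are continuous up to [t = 0], hence bounded over the
    compact product of [[0, t]] and the unit cube. This makes the norm of the gradient of [b]
    finite. *)
Lemma gradient_bounded (b : R -> E -> E) (t : R) : 0 <= t -> smooth_t_ge0 b ->
  (forall s, 0 <= s -> periodic (b s)) ->
  exists2 A, 0 <= A & forall s x k j, 0 <= s <= t -> `|gradmx (b s) x k j| <= A.
Proof.
move=> t0 [B [Bs bB]] bP.
have bE s : 0 <= s -> b s = (fun z => B (s, z)) by move=> s0; apply/funext => z; exact: bB.
have [_ C1] := Bs 1%N.
have cD (k : 'I_3) : continuous (fun z => euclid ('D_((0, 'e_k) : R * E) B z)).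
  move=> z; apply: (@continuous_comp _ _ _ ('D_((0, 'e_k) : R * E) B) (@euclid R)).
    by have [_ cc] := C1 (0, 'e_k); exact: cc.
  exact: continuous_euclid.
pose K : set (R * E) := `[0, t] `*` cube 0 1.
have K0 : K !=set0 by exists (0, 0); split => /= [|i]; rewrite in_itv/= ?mxE ?lexx ?ler01.
have cK : compact K by apply: compact_setX; [exact: segment_compact|exact: compact_cube].
have /choice[c cP] : forall k : 'I_3, exists c : R, forall z, K z -> euclid ('D_((0, 'e_k) : R * E) B z) <= c.
  move=> k; have [c _ cmax] := compact_EVT_max K0 cK (continuous_subspaceT (cD k)).
  by eexists => z Kz; apply: cmax; rewrite inE.
have c0 k : 0 <= c k.
  have [z Kz] := K0; exact: le_trans (euclid_ge0 _) (cP k z Kz).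
exists (\sum_k c k); first exact: sumr_ge0.
move=> s x k j /andP[s0 st]; rewrite mxE; apply: le_trans (abs_coord_le_euclid _ _) _.
have [m mP] := unit_cube_reduction x.
have pP : shift_periodic (pd k (b s)) by apply: shift_periodic_derive => i z; exact: bP.
rewrite -(shift_periodic_lattice m x pP) bE// pd_section.
apply: (@le_trans _ _ (c k)).
  by apply: cP; split => [|i] /=; rewrite in_itv/= ?s0.
by rewrite (bigD1 k)//= lerDl sumr_ge0.
Qed.

Lemma opnorm_sqrt_le (M : 'M[R]_3) (s G : R) : 0 < s ->
  opnorm (Num.sqrt s *: M) <= G -> opnorm M <= G / Num.sqrt s.
Proof.
move=> s0 H; have r0 : 0 < Num.sqrt s by rewrite sqrtr_gt0.
apply: opnorm_le => h h1; rewrite ler_pdivlMr//; apply: le_trans H.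
have := mulmx_opnorm h (Num.sqrt s *: M).
rewrite -scalemxAr euclidZ gtr0_norm// mulrC => /le_trans; apply.
by rewrite -[leRHS]mulr1; apply: ler_wpM2l => //; exact: opnorm_ge0.
Qed.

Lemma norm_0_to_gradient (b : R -> E -> E) (t : R) : 0 <= t -> smooth_t_ge0 b ->
  (forall s, 0 <= s -> periodic (b s)) ->
  exists G, [/\ 0 <= G, norm_0_to (fun s => gradmx (b s)) t = G%:E &
    forall s x, 0 < s <= t -> opnorm (gradmx (b s) x) <= G / Num.sqrt s].
Proof.
move=> t0 bs bP; have [A A0 AP] := gradient_bounded t0 bs bP.
set N := norm_0_to _ t.
have N0 : (0 <= N)%E.
  apply: (@le_trans _ _ (opnorm (Num.sqrt 0 *: gradmx (b 0) 0))%:E).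
    by rewrite lee_fin opnorm_ge0.
  by apply: ereal_sup_ubound; exists (0, 0) => //=; rewrite lexx.
have NA : (N <= (6 * (Num.sqrt t * A))%:E)%E.
  apply: ge_ereal_sup => _ [[s x] /= sK <-]; rewrite lee_fin.
  apply: opnorm_entries_le => i j; rewrite mxE normrM ger0_norm ?sqrtr_ge0//.
  apply: ler_pM => //.
    by have /andP[_ st] := sK; rewrite ler_wsqrtr.
  exact: AP.
have Nfin : N \is a fin_num.
  by rewrite ge0_fin_numE// (le_lt_trans NA)// ltry.
exists (fine N); split; [exact: fine_ge0|by rewrite fineK|].
move=> s x /andP[s0 st]; apply: opnorm_sqrt_le => //.
rewrite -lee_fin fineK//; apply: ereal_sup_ubound; exists (s, x) => //=.
by rewrite (ltW s0).
Qed.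

(** The maximum principles are stated for a positive bound [Om] on the initial vorticity; this
    passes to the limit and covers [Om = 0]. *)
Lemma le_of_gt_factor (x K Om : R) : 0 < K ->
  (forall y, Om < y -> x <= K * y) -> x <= K * Om.
Proof.
move=> K0 H; apply/ler_addgt0Pr => e e0.
have := H (Om + e / K); rewrite mulrDr mulrCA divff ?gt_eqF// mulr1; apply.
by rewrite ltrDl divr_gt0.
Qed.

End initial_data.

Section real_bounds.
Context {R : realType}.
Notation E := 'rV[R]_3.
Variables (u0 : E -> E) (b w v : R -> E -> E).
Hypotheses (u0s : smooth u0) (u0P : periodic u0)
  (sol : vorticity_solution b w (curl u0))
  (pois : forall t : R, 0 <= t -> poisson_solution (w t) (v t)).
Variables (t G : R).
Hypotheses (t0 : 0 <= t) (G0 : 0 <= G)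
  (bG : forall s x, 0 < s <= t -> opnorm (gradmx (b s) x) <= G / Num.sqrt s).

Lemma velocity_bound_of_vorticity (W : R) (x : E) :
  (forall y, euclid (w t y) <= W) -> euclid (v t x) <= 6 * W.
Proof.
move=> wW; have -> : 6 * W = 2 * (3 * W) by ring.
have [[_ _ C2 _ _] wP w0 _] := sol.
have wF y i : `|(w t y - 0) 0 i| <= W.
  by rewrite subr0; apply: le_trans (abs_coord_le_euclid _ _) (wW y).
apply: euclid_le => i; rewrite -(dot_delta i).
have [dw cdw] : (forall d y, derivable (w t) y 'e_d) /\
    (forall (d : 'I_3) n, continuous (fun y => dot n ('D_('e_d) (w t) y))).
  move: t0; rewrite le_eqVlt => /orP[/eqP t00|t0'].
    have -> : w t = curl u0 by apply/funext => y; rewrite -t00 w0.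
    by split=> *; [exact: derivable_curl|exact: continuous_dot_derive_curl].
  split=> [d y|d n]; first exact: (class_C2_derivable (C2 t t0')).
  by apply: continuous_dot; exact: (class_C2_cont_derive (C2 t t0')).
exact: (poisson_coord_bound dw cdw (wP t t0) (pois t0) wF).
Qed.

Variables (Om : R).
Hypothesis w0Om : forall x, euclid (curl u0 x) <= Om.

Lemma velocity_bound x :
  euclid (v t x) <= 6 * expR 1 * expR (2 * Num.sqrt t * G) * Om.
Proof.
have K0 : 0 < 6 * expR 1 * expR (2 * Num.sqrt t * G) by rewrite !mulr_gt0// expR_gt0.
move: t0; rewrite le_eqVlt => /orP[/eqP t00|t0'].
  have -> : 2 * Num.sqrt t * G = 0 by rewrite -t00 sqrtr0 mulr0 mul0r.
  rewrite expR0 mulr1.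
  have Om0 : 0 <= Om by apply: le_trans (w0Om 0); exact: euclid_ge0.
  apply: (@le_trans _ _ (6 * Om)).
    by apply: velocity_bound_of_vorticity => y; have [_ _ w0 _] := sol; rewrite -t00 w0.
  by rewrite -mulrA ler_pM2l// ler_peMl// ltW// -expR0 ltr_expR.
apply: le_of_gt_factor K0 _ => Om' Om'lt.
have Om'0 : 0 < Om'.
  by apply: le_lt_trans Om'lt; apply: le_trans (w0Om 0); exact: euclid_ge0.
have w0Om' y : euclid (curl u0 y) <= Om' by apply: le_trans (w0Om y) (ltW Om'lt).
have -> : 6 * expR 1 * expR (2 * Num.sqrt t * G) * Om' =
    6 * (Om' * expR (2 * G * Num.sqrt t + 1)).
  by rewrite expRD (mulrAC 2 G); ring.
apply: velocity_bound_of_vorticity => y.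
by apply: (vorticity_sup_bound t0' G0 Om'0 sol w0Om' bG); rewrite t0 lexx.
Qed.

(** The left-hand side is at most [48 (1 + y) (1 + z)], and [2 y <= 1 + y ^ 2] gives
    [1 + y <= 2 (1 + y ^ 2) <= 2 exp (y ^ 2)]. *)
Lemma exp_absorb (B : R) : 0 <= B -> 0 < t ->
  16 + 48 * (B * Num.sqrt t) + 4 * (G * Num.sqrt t) <=
  96 * (expR (t * B ^+ 2) * expR (Num.sqrt t * G)).
Proof.
move=> B0 t0'; set y := B * Num.sqrt t; set z := G * Num.sqrt t.
have y0 : 0 <= y by rewrite mulr_ge0// sqrtr_ge0.
have z0 : 0 <= z by rewrite mulr_ge0// sqrtr_ge0.
have -> : t * B ^+ 2 = y ^+ 2 by rewrite /y exprMn sqr_sqrtr// mulrC.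
rewrite (mulrC (Num.sqrt t)) -/z.
have e1 := expR_ge1Dx (y ^+ 2); have e2 := expR_ge1Dx z.
have y2 : 1 + y <= 2 * expR (y ^+ 2).
  by have := sqr_ge0 (y - 1); have := sqr_ge0 y; rewrite sqrrB1; lra.
have : (1 + y) * (1 + z) <= 2 * expR (y ^+ 2) * expR z.
  by apply: ler_pM => //; rewrite addr_ge0.
have := mulr_ge0 y0 z0; lra.
Qed.

Lemma velocity_gradient_bound (B : R) x : 0 < t -> 0 <= B ->
  (forall s y, 0 <= s -> euclid (b s y) <= B) ->
  opnorm (gradmx (v t) x) <=
  456 * 96 * expR 1 / Num.sqrt t * expR (t * B ^+ 2 + 3 * Num.sqrt t * G) * Om.
Proof.
move=> t0' B0 bB; have r0 : 0 < Num.sqrt t by rewrite sqrtr_gt0.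
have K0 : 0 < 456 * 96 * expR 1 / Num.sqrt t * expR (t * B ^+ 2 + 3 * Num.sqrt t * G).
  by rewrite !mulr_gt0 ?invr_gt0 ?expR_gt0 ?ltr0n.
apply: le_of_gt_factor K0 _ => Om' Om'lt.
have Om'0 : 0 < Om'.
  by apply: le_lt_trans Om'lt; apply: le_trans (w0Om 0); exact: euclid_ge0.
have w0Om' y : euclid (curl u0 y) <= Om' by apply: le_trans (w0Om y) (ltW Om'lt).
have wW := vorticity_sup_bound t0' G0 Om'0 sol w0Om' bG.
set W := Om' * _ in wW.
have W0 : 0 < W by rewrite mulr_gt0// expR_gt0.
have bB' s y k : 0 < s <= t -> `|b s y 0 k| <= B.
  by move=> /andP[s0 _]; apply: le_trans (abs_coord_le_euclid _ _) _; apply: bB; exact: ltW.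
have lip := vorticity_lipschitz t0' G0 B0 W0 sol bG bB' (fun s x => @wW s x).
set a := W / _ * _ in lip.
have X0 : 0 < 16 + 48 * (B * Num.sqrt t) + 4 * (G * Num.sqrt t).
  have := mulr_ge0 B0 (ltW r0); have := mulr_ge0 G0 (ltW r0); lra.
have a0 : 0 < a by rewrite /a mulr_gt0// divr_gt0.
have [[_ _ C2 _ _] wP _ _] := sol.
apply: le_trans (poisson_gradient_bound a0 (C2 t t0') (wP t t0) (pois t0) lip x) _.
have WE : W = Om' * (expR (2 * Num.sqrt t * G) * expR 1).
  by rewrite /W expRD (mulrAC 2 G).
(* The coefficient 3 is the 2 of the bound on the vorticity plus the 1 of [exp_absorb]. *)
have EE : expR (t * B ^+ 2 + 3 * Num.sqrt t * G) =
    expR (t * B ^+ 2) * (expR (2 * Num.sqrt t * G) * expR (Num.sqrt t * G)).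
  by rewrite -expRD -expRD; congr expR; ring.
have P0 : 0 < 456 * (W / Num.sqrt t) by rewrite mulr_gt0 ?ltr0n ?divr_gt0.
rewrite /a [leLHS]mulrA; apply: (@le_trans _ _ (456 * (W / Num.sqrt t) *
    (96 * (expR (t * B ^+ 2) * expR (Num.sqrt t * G))))).
  by rewrite (ler_pM2l P0); exact: exp_absorb.
rewrite WE EE.
set e1 := expR 1; set e2 := expR (2 * _ * _); set e3 := expR (t * _); set e4 := expR (_ * G).
set d := _^-1; by rewrite [leLHS](_ : _ = 456 * 96 * e1 * d * (e3 * (e2 * e4)) * Om'); last ring.
Qed.

End real_bounds.

(* At t = 0 the products 0 * +oo in the exponent are 0, by the convention of
   the library. *)
Theorem theorem6p4 (R : realType) (beta : R) (hbeta : 1 < beta) :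
  exists C1 C2 : R, [/\ 0 < C1, 0 < C2 &
    forall (u0 : 'rV[R]_3 -> 'rV[R]_3) (b w v : R -> 'rV[R]_3 -> 'rV[R]_3),
      smooth u0 -> (forall x, divergence u0 x = 0) -> periodic u0 ->
      smooth_t_ge0 b ->
      (forall (t : R) x, 0 <= t -> divergence (b t) x = 0) ->
      (forall t : R, 0 <= t -> periodic (b t)) ->
      (forall x, b 0 x = u0 x) ->
      vorticity_solution b w (curl u0) ->
      (forall t : R, 0 <= t -> poisson_solution (w t) (v t)) ->
      let gradb := norm_0_to (fun s => gradmx (b s)) in
      (forall (t : R) (x : 'rV[R]_3), 0 <= t -> (forall i, 0 <= x 0 i <= 1) ->
        ((euclid (v t x))%:E <=
          C1%:E * expeR ((C2 * t)%:E * sup_norm_t_ge0 b ^+ 2 +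
                         (2 * Num.sqrt t)%:E * gradb t)
          * sup_norm (curl u0))%E) /\
      (forall (t : R) (x : 'rV[R]_3), 0 < t -> (forall i, 0 <= x 0 i <= 1) ->
        ((opnorm (gradmx (v t) x))%:E <=
          (C1 / Num.sqrt t)%:E *
            expeR ((C2 * t)%:E * sup_norm_t_ge0 b ^+ 2 +
                   (3 * Num.sqrt t)%:E * gradb t)
          * sup_norm (curl u0))%E)].
Proof.
(* 456 comes from [poisson_gradient_bound], 96 from [exp_absorb] and [e] from the weight [s / t];
   the product also dominates the constant [6 e] of the first estimate. *)
pose C : R := 456 * 96 * expR 1.
have C0 : 0 < C by rewrite !mulr_gt0 ?ltr0n ?expR_gt0.
have C6 : 6 * expR 1 <= C by rewrite ler_wpM2r ?expR_ge0// -natrM ler_nat.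
have CE : 456 * 96 * expR 1 = C by [].
clearbody C; exists C, 1; split=> [//|//|u0 b w v u0s _ u0P bs _ bP _ sol pois gradb].
set Om := sup_norm (curl u0).
have Om0 : (0 <= Om)%E.
  apply: (@le_trans _ _ (euclid (curl u0 0))%:E); first by rewrite lee_fin euclid_ge0.
  by apply: ereal_sup_ubound; exists 0.
set Bn := sup_norm_t_ge0 b.
have Bn0 : (0 <= Bn)%E.
  apply: (@le_trans _ _ (euclid (b 0 0))%:E); first by rewrite lee_fin euclid_ge0.
  by apply: ereal_sup_ubound; exists (0, 0) => //=.
have bBn s y : 0 <= s -> ((euclid (b s y))%:E <= Bn)%E.
  by move=> s0; apply: ereal_sup_ubound; exists (s, y).
have w0Om x : ((euclid (curl u0 x))%:E <= Om)%E by apply: ereal_sup_ubound; exists x.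
clearbody Om Bn.
have tB0 (t : R) : 0 <= t -> (0 <= (1 * t)%:E * Bn ^+ 2)%E.
  by move=> t0; rewrite mule_ge0// ?sqre_ge0// lee_fin mul1r.
have exp_gt0 (t r G : R) : 0 <= t -> 0 <= r -> 0 <= G ->
    (0 < expeR ((1 * t)%:E * Bn ^+ 2 + r%:E * G%:E))%E.
  move=> t0 r0 G0; apply: expeR_gt0; apply: (@lt_le_trans _ _ 0%E); first exact: ltNy0.
  by apply: adde_ge0; [exact: tB0|rewrite -EFinM lee_fin mulr_ge0].
(* Proved at every [x], and not only in the unit cube, because the last case of the gradient
   estimate needs [v t] to vanish as a function. *)
have R1 t : 0 <= t -> forall x, ((euclid (v t x))%:E <=
    C%:E * expeR ((1 * t)%:E * Bn ^+ 2 + (2 * Num.sqrt t)%:E * gradb t) * Om)%E.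
  move=> t0 x; have [G [G0 GE bG]] := norm_0_to_gradient t0 bs bP.
  have s0 : 0 <= 2 * Num.sqrt t by rewrite mulr_ge0// sqrtr_ge0.
  rewrite [gradb t]GE; have epos := exp_gt0 t _ G t0 s0 G0.
  case: Om Om0 w0Om => [om|_ _|//]; last by rewrite gt0_muley ?leey// mule_gt0// lte_fin.
  rewrite lee_fin => om0 w0om.
  have w0om' y : euclid (curl u0 y) <= om by rewrite -lee_fin.
  have vb := velocity_bound u0s sol pois t0 G0 bG w0om' x.
  apply: (@le_trans _ _ (C%:E * (expR (2 * Num.sqrt t * G))%:E * om%:E)%E).
    rewrite -!EFinM lee_fin; apply: le_trans vb _.
    apply: ler_wpM2r => //; apply: ler_wpM2r; [exact: expR_ge0|exact: C6].
  apply: lee_wpmul2r; first by rewrite lee_fin.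
  apply: lee_wpmul2l; first by rewrite lee_fin ltW.
  have -> : (expR (2 * Num.sqrt t * G))%:E = expeR ((2 * Num.sqrt t)%:E * G%:E) by [].
  by rewrite lee_expeR leeDr// tB0.
split=> [t x t0 _|t x t0 _]; first exact: R1.
have t0' := ltW t0.
have [G [G0 GE bG]] := norm_0_to_gradient t0' bs bP.
have r0 : 0 < Num.sqrt t by rewrite sqrtr_gt0.
have s0 : 0 <= 3 * Num.sqrt t by rewrite mulr_ge0// ltW.
have epos := exp_gt0 t _ G t0' s0 G0.
have D0 : 0 < C / Num.sqrt t by rewrite divr_gt0.
rewrite [gradb t]GE.
case: Om Om0 w0Om R1 => [om|_ _ _|//]; last by rewrite gt0_muley ?leey// mule_gt0// lte_fin.
rewrite lee_fin => om0 w0om R1.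
have w0om' y : euclid (curl u0 y) <= om by rewrite -lee_fin.
case: Bn Bn0 bBn tB0 exp_gt0 R1 epos => [B|_ _ _ _ R1 _|//].
  rewrite lee_fin => B0 bB _ _ _ _.
  have bB' s y : 0 <= s -> euclid (b s y) <= B by move=> ?; rewrite -lee_fin; exact: bB.
  have := velocity_gradient_bound sol pois t0' G0 bG w0om' x t0 B0 bB'.
  by rewrite CE -EFin_expe -!EFinM lee_fin mul1r.
(* Here [||b||] is infinite. If [om] is positive the right-hand side is infinite, as [t > 0]; if
   [om] is 0 the first estimate forces [v t = 0]. *)
move: om0; rewrite le_eqVlt => /orP[/eqP om00|om0]; last first.
  rewrite expe2 mulyy gt0_muley ?lte_fin ?mul1r// addye; last by rewrite -EFinM.
  by rewrite /= gt0_muley ?lte_fin// gt0_mulye ?lte_fin// leey.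
have v0 : v t = cst 0.
  apply/funext => y; apply: euclid_eq0; apply/eqP; rewrite eq_le euclid_ge0 andbT.
  by have := R1 t t0' y; rewrite -om00 mule0 lee_fin.
rewrite -om00 mule0 lee_fin.
have := @opnorm_entries_le R (gradmx (v t) x) 0; rewrite mulr0; apply => i j.
by rewrite mxE /pd v0 derive_cst mxE normr0.
Qed.
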